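(* Let $R>0$ and let $h\in C^4_1(B_R)$. Assume: (i) there exist $k=(k_1,k_2)\in\mathbb{Z}^2\setminus\{0\}$, $a\in\mathbb{R}$ and a closed segment $S\subseteq L\cap B_R$, where $L=\{(I_1,I_2)\in\mathbb{R}^2 \mid k_1I_1+k_2I_2+a=0\}$, such that the restriction of $h$ to $S$ is constant; (ii) there exists a closed segment $S^*\subseteq S$ such that $\nabla h(I)\neq 0$ for all $I\in S^*$. Let $f\in\mathcal{F}^7_k$, that is, $f\in C^7_1(\mathbb{T}^2\times B_R)$ and there exist $I^*\in\mathrm{int}(S^* )$ and $\theta^*\in\mathbb{T}^2$ with $\partial_\theta\bar f^*_k(\theta^* )\neq 0$, where $\bar f^*_k(\theta)=\int_0^1 f(\theta+tk,I^* )\,dt$; fix such an $I^*$. Then there exist positive constants $C\geq 1$ and $c$, depending only on $h$ (with its data $R,k,a,S^*$), and positive constants $\varepsilon_0\leq 1$ and $\delta\leq 1$, depending also on $f$ (and $I^*,\theta^*$), such that for any $0<\varepsilon\leq\varepsilon_0$, the Hamiltonian system defined by $H=h+\varepsilon f$ on $\mathbb{T}^2\times B_R$ has a solution $(\theta(t),I(t))$ such that, for $\tau=\delta\varepsilon^{-1}$, $$|I(0)-I^*|\leq c\varepsilon,\qquad |I(\tau)-I(0)|\geq C\delta^2.$$ Moreover, for all $t\in[0,\tau]$, $d(I(t),S^* )\leq c\varepsilon$.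
   Context: $\mathbb{T}^2=\mathbb{R}^2/\mathbb{Z}^2$. $|\cdot|$ is the supremum norm on $\mathbb{R}^2$, $d$ is the induced distance, and $B_R=\{(I_1,I_2)\in\mathbb{R}^2 \mid |I_1|\leq R,\ |I_2|\leq R\}$. Segments are non-degenerate (of positive length), and $\mathrm{int}(S^* )$ is the segment $S^*$ without its endpoints. The $C^r$ norm of a function is the supremum over its domain and over all multi-indices $j$ with $|j|\leq r$ of $|\partial^j f|$; $C^r_1(\mathbb{T}^2\times B_R)$ (resp. $C^r_1(B_R)$) denotes the closed unit ball, for this norm, of the space of $C^r$ functions on $\mathbb{T}^2\times B_R$ (resp. on $B_R$). The Hamiltonian system defined by $H(\theta,I)=h(I)+\varepsilon f(\theta,I)$ is $\dot\theta=\partial_I H(\theta,I)$, $\dot I=-\partial_\theta H(\theta,I)$. *)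

(* Defs.v *)
From HB Require Import structures.
From mathcomp Require Export all_boot all_order all_algebra.
From mathcomp Require Export all_classical all_reals all_analysis.
Set Implicit Arguments.
Unset Strict Implicit.
Unset Printing Implicit Defensive.
Import Order.TTheory GRing.Theory Num.Theory.
Import numFieldNormedType.Exports.
Local Open Scope classical_set_scope.
Local Open Scope ring_scope.

(* Directional derivatives relative to a set D: the increments s are restricted
   to those with x + s v in D.  In the interior of D this is the usual
   derivative; on the faces of a box, or at the ends of a time interval, it is
   the one-sided derivative.  Values of f outside D are never used. *)
Section derivative_in.
Context {R : realType} {V W : normedModType R}.
Implicit Types (D : set V) (f : V -> W) (x v : V).

Definition dquot_in D f x v : set_system W :=
  (s^-1 *: (f (x + s *: v) - f x))
    @[s --> within [set s : R | D (x + s *: v)] (0 : R)^'].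

Definition is_derive_in D f x v (df : W) : Prop := dquot_in D f x v --> df.

Definition derivable_in D f x v : Prop := cvg (dquot_in D f x v).

Definition derive_in D f x v : W := lim (dquot_in D f x v).

End derivative_in.

Section Cr_functions.
Context {R : realType} {n : nat}.
Implicit Types (D : set 'rV[R]_n) (f : 'rV[R]_n -> R) (r : nat).

Definition partial_in D (i : 'I_n) f : 'rV[R]_n -> R :=
  fun x => derive_in D (f : 'rV[R]_n -> R^o) x (delta_mx 0 i).

Definition gradient_in D f (x : 'rV[R]_n) : 'rV[R]_n :=
  \row_i partial_in D i f x.

Definition partials_in D (s : seq 'I_n) f : 'rV[R]_n -> R :=
  foldr (partial_in D) f s.

Definition is_Cr D r f : Prop :=
  (forall s : seq 'I_n, (size s <= r)%N ->
     {within D, continuous (partials_in D s f)}) /\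
  (forall (s : seq 'I_n) (i : 'I_n), (size s < r)%N ->
     forall x, D x ->
       derivable_in D (partials_in D s f : 'rV[R]_n -> R^o) x (delta_mx 0 i)).

Definition multi_partial D (j : {ffun 'I_n -> nat}) f : 'rV[R]_n -> R :=
  partials_in D (flatten [seq nseq (j i) i | i <- enum 'I_n]) f.

Definition Cr_norm D r f : \bar R :=
  ereal_sup [set y | exists (j : {ffun 'I_n -> nat}) x,
    [/\ (\sum_i j i <= r)%N, D x & y = (`|multi_partial D j f x|)%:E]].

Definition Cr_unit_ball D r f : Prop :=
  is_Cr D r f /\ (Cr_norm D r f <= 1)%E.

End Cr_functions.

Section hamiltonian.
Context {R : realType}.

Definition action_box (rho : R) : set 'rV[R]_2 :=
  [set I | `|I 0 0| <= rho /\ `|I 0 1| <= rho].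

(* T^2 x B_rho: a point (theta, I) is [row_mx theta I], with theta in the
   universal cover R^2 of the torus. *)
Definition phase_space (rho : R) : set 'rV[R]_(2 + 2) :=
  [set x | action_box rho (rsubmx x)].

Definition torus_periodic (rho : R) (f : 'rV[R]_(2 + 2) -> R) : Prop :=
  forall (theta I : 'rV[R]_2) (m : 'rV[int]_2), action_box rho I ->
    f (row_mx (theta + map_mx intr m) I) = f (row_mx theta I).

Definition torus_Cr_unit_ball (rho : R) (r : nat) (f : 'rV[R]_(2 + 2) -> R) :
    Prop :=
  torus_periodic rho f /\ Cr_unit_ball (phase_space rho) r f.

Definition resonant_line (k : 'rV[int]_2) (a : R) : set 'rV[R]_2 :=
  [set I | (k 0 0)%:~R * I 0 0 + (k 0 1)%:~R * I 0 1 + a = 0].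

Definition segment (p q : 'rV[R]_2) : set 'rV[R]_2 :=
  [set (1 - t) *: p + t *: q | t in `[0, 1]%classic].

Definition segment_int (p q : 'rV[R]_2) : set 'rV[R]_2 :=
  segment p q `\` [set p; q].

(* The norm of ['rV_2] is the supremum norm. *)
Definition dist_set (x : 'rV[R]_2) (A : set 'rV[R]_2) : R :=
  inf [set `|x - y| | y in A].

Definition resonant_average (f : 'rV[R]_(2 + 2) -> R) (k : 'rV[int]_2)
    (I : 'rV[R]_2) (theta : 'rV[R]_2) : R :=
  \int[lebesgue_measure]_(t in `[0, 1]%classic)
    f (row_mx (theta + t *: map_mx intr k) I).

Definition perturbed (h : 'rV[R]_2 -> R) (eps : R) (f : 'rV[R]_(2 + 2) -> R) :
    'rV[R]_(2 + 2) -> R :=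
  fun x => h (rsubmx x) + eps * f x.

Definition grad_theta (rho : R) (H : 'rV[R]_(2 + 2) -> R) x : 'rV[R]_2 :=
  lsubmx (gradient_in (phase_space rho) H x).

Definition grad_I (rho : R) (H : 'rV[R]_(2 + 2) -> R) x : 'rV[R]_2 :=
  rsubmx (gradient_in (phase_space rho) H x).

(* A solution on [0, tau] that stays in T^2 x B_rho; the theta component is
   lifted to R^2. *)
Definition hamiltonian_solution (rho : R) (H : 'rV[R]_(2 + 2) -> R) (tau : R)
    (theta I : R -> 'rV[R]_2) : Prop :=
  forall t : R, 0 <= t <= tau ->
    [/\ action_box rho (I t),
        is_derive_in (`[0, tau]%classic : set R^o) (theta : R^o -> 'rV[R]_2) t 1
          (grad_I rho H (row_mx (theta t) (I t))) &
        is_derive_in (`[0, tau]%classic : set R^o) (I : R^o -> 'rV[R]_2) t 1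
          (- grad_theta rho H (row_mx (theta t) (I t)))].

End hamiltonian.

(* Main.v *)
Require Import Defs.
From mathcomp Require Import ring lra.
Import Order.TTheory GRing.Theory Num.Theory.
Import numFieldNormedType.Exports.
Set Implicit Arguments.
Unset Strict Implicit.
Unset Printing Implicit Defensive.
Local Open Scope classical_set_scope.
Local Open Scope ring_scope.

(** On [S^*] the gradient of [h] is a nonzero multiple of [k], so [h] measures the
    distance to the segment, and conservation of [h + eps f] keeps every orbit
    starting [O(eps)]-close to it at distance [O(eps)] as long as it has moved by
    [O(delta)] only. If the segment lies in a face of the box, a start shifted
    inwards by a multiple of [eps] has an energy differing by more than [2 eps]
    from that of the face, which the orbit therefore never reaches. Along the
    orbit the angle runs in the direction [k], up to [O(delta)], with speed close
    to a constant [lam <> 0], so that over the time [delta / eps] the force in the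
    direction orthogonal to [k] may be replaced by its average along [k], with an
    error absorbed by a bounded corrector. That average is nonzero at [thetas] and
    the drift is of order [delta], which beats [delta^2] for small [delta].
    Derivatives along curves are handled through expansions
    [u t - u s = (t - s) e(s) + O((t - s)^2)]. *)

(** * Quadratic expansions and primitives *)

(** The constants are fixed in the order [c], [delta], [eps0]. Choosing [c] before [f] is possible
    because [|f| <= 1]: whatever [f] is, [h] varies by at most [2 * eps] along an orbit in the box,
    so [c] involves only [rho], [k], a Lipschitz constant of [h] and the minimum of the
    [k]-component of [grad h] on the segment. Every constant that depends on [f] is absorbed by
    [delta], and [eps0 <= delta ^+ 2] makes each term [O(eps)] negligible against the drift.

    Two accuracies must be kept apart. The orbit is [O(eps)]-close to the segment, but only
    [O(delta)]-close to [I^*]. The angular velocity orthogonal to [k] vanishes, up to [O(eps)],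
    along the whole segment, so the first estimate bounds the transverse displacement over the time
    [delta / eps] by [O(delta)]; the second would only give [delta ^+ 2 / eps]. For the speed along
    [k], which varies along the segment, the second one is available and suffices.

    Expansions with a uniform quadratic error are stable under sums, composition and limits, and
    bisection integrates them; existence, energy conservation and averaging thus take the same form,
    also where derivatives are one-sided. *)

Section row_norm.
Context {R : realType} {n : nat}.
Implicit Types x y : 'rV[R]_n.

Lemma rV_norm_leP x (M : R) : 0 <= M -> (forall i, `|x 0 i| <= M) -> `|x| <= M.
Proof.
move=> M0 xM; rewrite [leLHS]/Num.norm /= mx_normrE.
by apply/bigmax_leP; split => // -[i j] _ /=; rewrite ord1.
Qed.

Lemma rV_coord_le x i : `|x 0 i| <= `|x|.
Proof.
rewrite [leRHS]/Num.norm /= mx_normrE.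
by apply/bigmax_geP; right => /=; exists (0, i).
Qed.

Lemma rV_coordB_le x y i : `|x 0 i - y 0 i| <= `|x - y|.
Proof. by have := rV_coord_le (x - y) i; rewrite !mxE. Qed.

End row_norm.

Section quadratic_calculus.
Context {R : realType}.
Implicit Types (u w g : R -> R) (K T : R).

(** Since [c * 2^-n] tends to zero, a limit is taken as a plain inequality. Bisection, Picard
    iteration and the continuation argument all end this way. *)
Lemma le_add_geometric (x y c : R) :
  (forall n, x <= y + c * (2^-1) ^+ n) -> x <= y.
Proof.
move=> H; apply/ler_addgt0Pr => e e0.
have [c0|c0] := leP c 0.
  by have := H 0%N; rewrite expr0; lra.
have h2 : `|2^-1 : R| < 1 by rewrite ger0_norm; lra.
have /cvgrPdist_le /(_ (e / c)) := cvg_expr h2.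
case; first by rewrite divr_gt0.
move=> N _ /(_ N (leqnn N)) /=; rewrite sub0r normrN => hN.
apply: le_trans (H N) _; rewrite lerD2l.
have {}hN := le_trans (ler_norm _) hN.
by rewrite mulrC -ler_pdivlMr.
Qed.

(* Halving [s, t] halves the quadratic term while [w t - w s] is additive. *)
Lemma bisection_bound u w K T :
  (forall s t, 0 <= s -> s <= t -> t <= T ->
    `|u t - u s| <= w t - w s + K * (t - s) ^+ 2) ->
  forall s t, 0 <= s -> s <= t -> t <= T -> `|u t - u s| <= w t - w s.
Proof.
move=> H.
have Hn n : forall s t, 0 <= s -> s <= t -> t <= T ->
    `|u t - u s| <= w t - w s + K * (t - s) ^+ 2 * (2^-1) ^+ n.
  elim: n => [|n IH] s t s0 st tT; first by rewrite expr0 mulr1; exact: H.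
  pose r := (s + t) / 2.
  have := IH s r s0; have := IH r t; rewrite /r.
  have -> : t - (s + t) / 2 = (t - s) / 2 by field.
  have -> : (s + t) / 2 - s = (t - s) / 2 by field.
  move=> /(_ ltac:(lra) ltac:(lra) ltac:(lra)) h1.
  move=> /(_ ltac:(lra) ltac:(lra)) h2.
  rewrite -/r in h1 h2.
  have -> : u t - u s = (u t - u r) + (u r - u s) by ring.
  apply: le_trans (ler_normD _ _) _.
  move: h1 h2; rewrite [2^-1 ^+ n.+1](exprS (2^-1 : R) n).
  set e := (2^-1) ^+ n; set d := t - s.
  have -> : K * (d / 2) ^+ 2 * e = K * d ^+ 2 * (2^-1 * e) / 2 by field.
  lra.
move=> s t s0 st tT; apply: (@le_add_geometric _ _ (K * (t - s) ^+ 2)) => n.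
exact: Hn.
Qed.

(** Mean value inequality without derivatives: [w t = A * t] satisfies the hypothesis of
    [bisection_bound]. *)
Lemma slope_bound u (e : R -> R) A K T :
  (forall s t, 0 <= s -> s <= t -> t <= T ->
    `|u t - u s - (t - s) * e s| <= K * (t - s) ^+ 2) ->
  (forall s, 0 <= s -> s <= T -> `|e s| <= A) ->
  forall s t, 0 <= s -> s <= t -> t <= T -> `|u t - u s| <= A * (t - s).
Proof.
move=> H He s t s0 st tT.
have := @bisection_bound u (fun t => A * t) K T _ s t s0 st tT.
rewrite /= -mulrBr; apply => {t st tT s s0} s t s0 st tT.
rewrite -mulrBr.
have -> : u t - u s = (u t - u s - (t - s) * e s) + (t - s) * e s by ring.
apply: le_trans (ler_normD _ _) _; rewrite addrC lerD //; last exact: H.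
rewrite normrM (@ger0_norm _ (t - s)) ?subr_ge0 // mulrC.
by rewrite ler_wpM2r ?subr_ge0 // He //; lra.
Qed.

End quadratic_calculus.

Section primitive.
Context {R : realType}.
Notation mu := (@lebesgue_measure R).
Implicit Types g : R -> R.

(* One of the two intervals is empty or a point. *)
Definition primitive g (t : R) : R :=
  \int[mu]_(s in `[0, t]%classic) g s - \int[mu]_(s in `[t, 0]%classic) g s.

Lemma lipschitz_continuous g K :
  (forall s t, `|g t - g s| <= K * `|t - s|) -> continuous g.
Proof.
move=> H s; apply/cvgrPdist_le => /= e e0.
have hK : 0 < e / (`|K| + 1) by rewrite divr_gt0 // ltr_wpDl.
have hs : \forall t \near s, `|s - t| <= e / (`|K| + 1).
  by have /cvgrPdist_le/(_ _ hK) : id @ s --> s by exact: cvg_id.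
near=> t.
rewrite distrC; apply: le_trans (H s t) _.
have : `|s - t| <= e / (`|K| + 1) by near: t.
rewrite distrC ler_pdivlMr ?ltr_wpDl // => h.
apply: le_trans h; rewrite mulrC ler_wpM2l //.
by apply: le_trans (ler_norm _) _; rewrite lerDl.
Unshelve. all: by end_near. Qed.

Lemma continuous_segment_integrable g a b :
  continuous g -> mu.-integrable `[a, b]%classic (EFin \o g).
Proof.
move=> cg; apply: continuous_compact_integrable; first exact: segment_compact.
exact: continuous_subspaceT.
Qed.

Lemma Rintegral_itv_chasles g a b c : continuous g -> a <= b -> b <= c ->
  \int[mu]_(s in `[a, c]%classic) g s =
  \int[mu]_(s in `[a, b]%classic) g s + \int[mu]_(s in `[b, c]%classic) g s.
Proof.
move=> cg ab bc.
have := @Rintegral_itvB _ g (BLeft a) (BRight c) b.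
rewrite !bnd_simp => /(_ (continuous_segment_integrable _ _ cg) ab bc).
rewrite Rintegral_itv_obnd_cbnd; last first.
  apply: integrableS (continuous_segment_integrable b c cg) => //.
  exact: subset_itv_oc_cc.
by move=> <-; ring.
Qed.

Lemma Rintegral_itv_ge g a b : b <= a ->
  \int[mu]_(s in `[a, b]%classic) g s = 0.
Proof.
rewrite le_eqVlt => /predU1P[->|ba]; first by rewrite set_itv1 Rintegral_set1.
by rewrite set_itv_ge ?Rintegral_set0 // bnd_simp -ltNge.
Qed.

Lemma primitiveB g s t : continuous g -> s <= t ->
  primitive g t - primitive g s = \int[mu]_(x in `[s, t]%classic) g x.
Proof.
move=> cg st; rewrite /primitive.
have [s0|s0] := leP 0 s.
  rewrite (@Rintegral_itv_ge _ t 0) ?(@Rintegral_itv_ge _ s 0) //; last lra.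
  rewrite (Rintegral_itv_chasles cg s0 st); ring.
have [t0|t0] := leP 0 t.
  rewrite (@Rintegral_itv_ge _ t 0) ?(@Rintegral_itv_ge _ 0 s) //; last lra.
  rewrite (Rintegral_itv_chasles cg (ltW s0) t0); ring.
rewrite (@Rintegral_itv_ge _ 0 t) ?(@Rintegral_itv_ge _ 0 s) //; try lra.
rewrite (Rintegral_itv_chasles cg st (ltW t0)); ring.
Qed.

(** For [s <= t] the integral of [g - g s] over [[s, t]] is at most [K * (t - s) ^+ 2]. For [t < s]
    that bound is centred at [t], and recentring at [s] costs the same amount again, whence the
    factor 2. *)
Lemma primitive_quadratic g K : 0 <= K ->
  (forall s t, `|g t - g s| <= K * `|t - s|) ->
  forall s t, `|primitive g t - primitive g s - (t - s) * g s|
    <= 2 * K * (t - s) ^+ 2.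
Proof.
move=> K0 H; have cg := lipschitz_continuous H.
have Hle s t : s <= t ->
    `|primitive g t - primitive g s - (t - s) * g s| <= K * (t - s) ^+ 2.
  move=> st; rewrite primitiveB //.
  have mst : fine (mu `[s, t]%classic) = t - s.
    rewrite lebesgue_measure_itv /= lte_fin.
    by case: ltgtP st => // ->; rewrite subrr.
  have -> : (t - s) * g s = \int[mu]_(x in `[s, t]%classic) (g s).
    by rewrite Rintegral_cst // mulrC; congr (_ * _); rewrite -mst.
  have cs : continuous (fun _ : R => g s) by move=> x; exact: cst_continuous.
  rewrite -RintegralB //; try exact: continuous_segment_integrable.
  have cB : continuous (fun x => g x - g s).
    by move=> x; apply: continuousB; [exact: cg|exact: cst_continuous].
  apply: le_trans (le_normr_Rintegral _ _) _ => //.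
    exact: continuous_segment_integrable.
  apply: (@le_trans _ _ (\int[mu]_(x in `[s, t]%classic) (K * (t - s)))).
    apply: le_Rintegral => //.
    - apply: continuous_segment_integrable.
      apply: (@lipschitz_continuous _ K) => x y.
      apply: le_trans (ler_dist_dist _ _) _.
      by rewrite (_ : _ - _ = g y - g x) //; ring.
    - by apply: continuous_segment_integrable => x; exact: cst_continuous.
    move=> x /=; rewrite in_itv /= => /andP[sx xt].
    apply: le_trans (H _ _) _; rewrite ler_wpM2l //.
    by rewrite ger0_norm; lra.
  by rewrite Rintegral_cst //; rewrite [X in _ * X]mst expr2 mulrA.
move=> s t; have [st|ts] := leP s t.
  by apply: le_trans (Hle _ _ st) _; rewrite ler_wpM2r ?sqr_ge0 //; lra.
have h := Hle _ _ (ltW ts).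
have -> : primitive g t - primitive g s - (t - s) * g s =
  - (primitive g s - primitive g t - (s - t) * g t)
   + (s - t) * (g s - g t) by ring.
apply: le_trans (ler_normD _ _) _; rewrite normrN normrM.
have -> : 2 * K * (t - s) ^+ 2 = K * (s - t) ^+ 2 + K * (s - t) ^+ 2 by ring.
rewrite lerD //.
have := H t s; rewrite (@ger0_norm _ (s - t)) ?subr_ge0 ?(ltW ts) // => h2.
rewrite expr2 mulrCA ler_wpM2l ?subr_ge0 ?(ltW ts) //.
Qed.

Lemma primitive0 g : primitive g 0 = 0.
Proof. by rewrite /primitive subrr. Qed.

End primitive.

(** * Existence of trajectories *)

Lemma halfX_ge0 {R : realType} m : 0 <= 2^-1 ^+ m :> R.
Proof. by rewrite exprn_ge0 // invr_ge0. Qed.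

(** Nested intervals: [a m - 2 * b * 2^-m] increases and [a m + 2 * b * 2^-m] decreases; the limit
    is the supremum of the lower ends. *)
Lemma geometric_limit {R : realType} (a : nat -> R) (b : R) :
  (forall m, `|a m.+1 - a m| <= b * 2^-1 ^+ m) ->
  exists l, forall m, `|l - a m| <= 2 * b * 2^-1 ^+ m.
Proof.
move=> H.
pose c m := a m - 2 * b * 2^-1 ^+ m.
pose d m := a m + 2 * b * 2^-1 ^+ m.
have b0 : 0 <= b by have := H 0%N; rewrite expr0; have := normr_ge0 (a 1%N - a 0%N); lra.
have step m : c m <= c m.+1 /\ d m.+1 <= d m.
  have := H m; rewrite /c /d ler_norml exprS.
  by set e := 2^-1 ^+ m => h; split; lra.
have cn : {homo c : m p / (m <= p)%N >-> m <= p}.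
  by apply: homo_leq => [//|x y z|m]; [exact: le_trans|case: (step m)].
have dn : {homo d : m p / (m <= p)%N >-> p <= m}.
  by apply: homo_leq => [//|y x z xy yz|m]; [exact: le_trans yz xy|case: (step m)].
have cd m p : c p <= d m.
  apply: le_trans (cn _ _ (leq_maxl p m)) _.
  apply: le_trans (dn _ _ (leq_maxr p m)).
  rewrite /c /d; set q := maxn p m.
  have : 0 <= b * 2^-1 ^+ q by rewrite mulr_ge0 // exprn_ge0.
  lra.
have hs : has_sup (range c).
  by split; [exists (c 0%N), 0%N|exists (d 0%N) => _ [p _ <-]].
exists (sup (range c)) => m; rewrite ler_norml; apply/andP; split.
  have : c m <= sup (range c) by apply: ub_le_sup; [case: hs|exists m].
  by rewrite /c; lra.
have : sup (range c) <= d m by apply: ge_sup => [|_ [p _ <-]]; [case: hs|].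
by rewrite /d; lra.
Qed.

Lemma primitive_lipschitz {R : realType} (g : R -> R) (K M : R) : 0 <= K ->
  (forall s t, `|g t - g s| <= K * `|t - s|) -> (forall t, `|g t| <= M) ->
  forall s t, `|primitive g t - primitive g s| <= M * `|t - s|.
Proof.
move=> K0 gK gM.
have Hle s t : s <= t -> `|primitive g t - primitive g s| <= M * (t - s).
  move=> st.
  have := @slope_bound R (fun r => primitive g (s + r)) (fun r => g (s + r)) M
    (2 * K) (t - s) _ _ 0 (t - s).
  rewrite subr0 addr0 (addrC s) subrK; apply => //; last by rewrite subr_ge0.
  move=> r q _ _ _; have := primitive_quadratic K0 gK (s + r) (s + q).
  by have -> : s + q - (s + r) = q - r by ring.
move=> s t; have [st|ts] := leP s t.
  by rewrite (@ger0_norm _ (t - s)) ?subr_ge0 //; exact: Hle.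
rewrite distrC (distrC t s) (@ger0_norm _ (s - t)) ?subr_ge0 ?(ltW ts) //.
exact/Hle/ltW.
Qed.

Section picard.
Context {R : realType} {n : nat}.
Variables (F : 'rV[R]_n -> 'rV[R]_n) (L M : R) (x0 : 'rV[R]_n).
Hypothesis L0 : 0 < L.
Hypothesis F_lip : forall x y, `|F y - F x| <= L * `|y - x|.
Hypothesis F_bnd : forall x, `|F x| <= M.

Fixpoint picard (m : nat) (t : R) : 'rV[R]_n :=
  if m is m'.+1 then x0 + \row_i primitive (fun s => F (picard m' s) 0 i) t
  else x0.

Let M0 : 0 <= M. Proof. exact: le_trans (normr_ge0 _) (F_bnd x0). Qed.

Lemma picardS m t i :
  picard m.+1 t 0 i = x0 0 i + primitive (fun s => F (picard m s) 0 i) t.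
Proof. by rewrite /= !mxE. Qed.

Lemma picard0 m : picard m 0 = x0.
Proof.
case: m => // m; apply/rowP => i.
by rewrite (_ : 0 = ord0) // picardS primitive0 addr0.
Qed.

(** The bound on [F] makes the constant independent of [m]; all iterates therefore have expansions
    with one and the same quadratic constant, which survives in the limit. *)
Lemma picard_lipschitz m s t : `|picard m t - picard m s| <= M * `|t - s|.
Proof.
elim: m s t => [|m IH] s t; first by rewrite subrr normr0 mulr_ge0.
apply: rV_norm_leP => [|i]; first by rewrite mulr_ge0.
have -> : (picard m.+1 t - picard m.+1 s) 0 i =
   primitive (fun s => F (picard m s) 0 i) t
   - primitive (fun s => F (picard m s) 0 i) s by rewrite /= !mxE; ring.
apply: (@primitive_lipschitz _ _ (L * M)); first by rewrite mulr_ge0 // ltW.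
  move=> a b; have := rV_coord_le (F (picard m b) - F (picard m a)) i.
  rewrite !mxE => h; apply: le_trans h _; apply: le_trans (F_lip _ _) _.
  by rewrite -mulrA ler_wpM2l ?(ltW L0).
by move=> a; apply: le_trans (rV_coord_le _ _) (F_bnd _).
Qed.

Lemma picard_quadratic m s t i :
  `|picard m.+1 t 0 i - picard m.+1 s 0 i - (t - s) * F (picard m s) 0 i|
  <= 2 * (L * M) * (t - s) ^+ 2.
Proof.
rewrite !picardS.
have -> : forall a b c : R, x0 0 i + a - (x0 0 i + b) - c = a - b - c.
  by move=> a b c; ring.
apply: (@primitive_quadratic _ (fun r => F (picard m r) 0 i)).
  by rewrite mulr_ge0 // ltW.
move=> a b; have := rV_coord_le (F (picard m b) - F (picard m a)) i.
rewrite !mxE => h; apply: le_trans h _; apply: le_trans (F_lip _ _) _.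
by rewrite -mulrA ler_wpM2l ?(ltW L0) ?picard_lipschitz.
Qed.

(* With the weight [expR (2 * L * t)] each iteration halves the distance. *)
Lemma picard_contraction m t : 0 <= t ->
  `|picard m.+1 t - picard m t| <= M / (2 * L) * 2^-1 ^+ m * expR (2 * L * t).
Proof.
set B := M / (2 * L).
have B0 : 0 <= B by rewrite divr_ge0 // mulr_ge0 // ltW.
have W0 p r : 0 <= B * 2^-1 ^+ p * expR r.
  by rewrite mulr_ge0 ?expR_ge0 // mulr_ge0 // halfX_ge0.
elim: m t => [|m IH] t t0.
  have := picard_lipschitz 1 0 t; rewrite picard0 subr0 ger0_norm // => h.
  apply: le_trans h _; rewrite expr0 mulr1.
  have -> : M * t = B * (2 * L * t) by rewrite /B; field; rewrite gt_eqF.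
  rewrite ler_wpM2l //; have := expR_ge1Dx (2 * L * t); lra.
apply: rV_norm_leP => [|i]; first exact: W0.
pose u t := picard m.+2 t 0 i - picard m.+1 t 0 i.
pose w t := B * 2^-1 ^+ m.+1 * expR (2 * L * t).
have := @bisection_bound _ u w (4 * (L * M)) t.
have -> : (picard m.+2 t - picard m.+1 t) 0 i = u t by rewrite /u !mxE.
move=> /(_ _ 0 t (lexx _) t0 (lexx _)).
have -> : u 0 = 0 by rewrite /u !picard0 subrr.
rewrite subr0 => H; apply: le_trans (H _) _; last first.
  by rewrite lerBlDr lerDl W0.
move=> s r s0 sr _.
pose e := F (picard m.+1 s) 0 i - F (picard m s) 0 i.
have h1 := picard_quadratic m.+1 s r i.
have h2 := picard_quadratic m s r i.
have he : `|e| <= L * (B * 2^-1 ^+ m * expR (2 * L * s)).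
  have h := rV_coordB_le (F (picard m.+1 s)) (F (picard m s)) i.
  apply: le_trans h _; apply: le_trans (F_lip _ _) _.
  by rewrite ler_wpM2l ?(ltW L0) ?IH.
(* The weight [w] grows at rate [2 * L * w] and carries one more factor 1/2 than the bound on the
   previous iterate, so its growth dominates [L] times that bound. The inequality [1 + y <= expR y]
   gives this without differentiating. *)
have hw : (r - s) * (L * (B * 2^-1 ^+ m * expR (2 * L * s))) <= w r - w s.
  have -> : w r - w s = B * 2^-1 ^+ m * expR (2 * L * s) *
      (2^-1 * (expR (2 * L * (r - s)) - 1)).
    have -> : w r = B * 2^-1 ^+ m.+1 * (expR (2 * L * s) * expR (2 * L * (r - s))).
      by rewrite -expRD /w; congr (_ * expR _); ring.
    by rewrite /w exprS; ring.
  have he1 : (r - s) * L <= 2^-1 * (expR (2 * L * (r - s)) - 1).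
    by have := expR_ge1Dx (2 * L * (r - s)); lra.
  by have := ler_wpM2l (W0 m (2 * L * s)) he1; lra.
have -> : u r - u s =
  (picard m.+2 r 0 i - picard m.+2 s 0 i - (r - s) * F (picard m.+1 s) 0 i)
  - (picard m.+1 r 0 i - picard m.+1 s 0 i - (r - s) * F (picard m s) 0 i)
  + (r - s) * e by rewrite /u /e; ring.
apply: le_trans (ler_normD _ _) _.
have h3 := ler_normB
  (picard m.+2 r 0 i - picard m.+2 s 0 i - (r - s) * F (picard m.+1 s) 0 i)
  (picard m.+1 r 0 i - picard m.+1 s 0 i - (r - s) * F (picard m s) 0 i).
rewrite normrM (@ger0_norm _ (r - s)) ?subr_ge0 //.
have h4 : (r - s) * `|e| <= (r - s) * (L * (B * 2^-1 ^+ m * expR (2 * L * s))).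
  by rewrite ler_wpM2l ?subr_ge0.
lra.
Qed.

(** The solution is delivered as a quadratic expansion: [picard_quadratic] is uniform in [m] and
    passes to the pointwise limit, so the limit is neither differentiated nor integrated. *)
Lemma cauchy_lipschitz : exists x : R -> 'rV[R]_n,
  x 0 = x0 /\ forall s t, 0 <= s -> 0 <= t ->
    `|x t - x s - (t - s) *: F (x s)| <= 2 * (L * M) * (t - s) ^+ 2.
Proof.
pose b t := 2 * (M / (2 * L) * expR (2 * L * t)).
have Hl (t : R) : exists y : 'rV[R]_n, 0 <= t ->
    forall m, `|y - picard m t| <= b t * 2^-1 ^+ m.
  have [t0|t0] := leP 0 t; last by exists 0.
  have Hi (i : 'I_n) : exists l : R,
      forall m, `|l - picard m t 0 i| <= b t * 2^-1 ^+ m.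
    apply: (geometric_limit (a := fun m => picard m t 0 i)) => m.
    have := rV_coordB_le (picard m.+1 t) (picard m t) i => h.
    apply: le_trans h _; apply: le_trans (picard_contraction m t0) _.
    by rewrite mulrAC.
  have [l Hl] := choice Hi; exists (\row_i l i) => _ m.
  apply: rV_norm_leP => [|i].
    by apply: le_trans (normr_ge0 (x0 - x0)) _; rewrite subrr normr0
      /b !mulr_ge0 ?halfX_ge0 ?expR_ge0 ?invr_ge0 // mulr_ge0 // ltW.
  by have := Hl i m; rewrite !mxE.
have [x Hx] := choice Hl; exists x; split.
  apply/eqP; rewrite -subr_eq0 -normr_le0.
  apply: (@le_add_geometric _ _ _ (b 0)) => m.
  by rewrite add0r; have := Hx 0 (lexx _) m; rewrite picard0.
move=> s t s0 t0; apply: rV_norm_leP => [|i].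
  by rewrite mulr_ge0 ?sqr_ge0 // !mulr_ge0 // ltW.
(* The three terms are the costs of replacing [x t], [x s] and [F (x s)] by the corresponding
   iterates. *)
apply: (@le_add_geometric _ _ _ (b t + b s + `|t - s| * L * b s)) => m.
rewrite !mxE.
have bb r : 0 <= r -> b r * 2^-1 ^+ m.+1 <= b r * 2^-1 ^+ m.
  move=> r0; have : 0 <= b r * 2^-1 ^+ m.
    exact: le_trans (normr_ge0 _) (Hx r r0 m).
  by rewrite exprS; lra.
have ht := le_trans (Hx t t0 m.+1) (bb t t0).
have hs := le_trans (Hx s s0 m.+1) (bb s s0).
move: (rV_coordB_le (x t) (picard m.+1 t) i) => /le_trans/(_ ht) {}ht.
move: (rV_coordB_le (x s) (picard m.+1 s) i) => /le_trans/(_ hs) {}hs.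
have hF : `|F (x s) 0 i - F (picard m s) 0 i| <= L * (b s * 2^-1 ^+ m).
  have := rV_coordB_le (F (x s)) (F (picard m s)) i => h.
  apply: le_trans h _; apply: le_trans (F_lip _ _) _.
  by rewrite ler_wpM2l ?(ltW L0) ?Hx.
have hq := picard_quadratic m s t i.
set P := picard m.+1 in ht hs hq *; set G := F (picard m s) 0 i in hF hq *.
have -> : x t 0 i - x s 0 i - (t - s) * F (x s) 0 i =
  (P t 0 i - P s 0 i - (t - s) * G) + (x t 0 i - P t 0 i) - (x s 0 i - P s 0 i)
   - (t - s) * (F (x s) 0 i - G) by ring.
apply: le_trans (ler_normB _ _) _; rewrite normrM.
have h1 := ler_normB (P t 0 i - P s 0 i - (t - s) * G + (x t 0 i - P t 0 i))
  (x s 0 i - P s 0 i).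
have h2 := ler_normD (P t 0 i - P s 0 i - (t - s) * G) (x t 0 i - P t 0 i).
have h3 := ler_wpM2l (normr_ge0 (t - s)) hF.
lra.
Qed.

End picard.

(** * Mean value theorem on boxes *)

Section mean_value.
Context {R : realType} {n : nat}.
Implicit Types (D : set 'rV[R]_n) (g : 'rV[R]_n -> R) (x y z : 'rV[R]_n).
Local Notation e_ i := (delta_mx 0 i : 'rV[R]_n).

(** Ordinary convexity would not suffice: a path from [x] to [y] that changes one coordinate at a
    time has to stay in [D], because only partial derivatives are at hand. *)
Definition box_convex D := forall x y z, D x -> D y ->
  (forall i, (x 0 i <= z 0 i <= y 0 i) || (y 0 i <= z 0 i <= x 0 i)) -> D z.

Lemma axis_coord x (s : R) i j :
  (x + s *: e_ i) 0 j = x 0 j + (if j == i then s else 0).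
Proof. by rewrite !mxE eqxx /=; case: eqP; rewrite ?mulr1 ?mulr0. Qed.

Lemma box_convex_axis D x (s r : R) i : box_convex D -> D x ->
  D (x + s *: e_ i) -> (0 <= r <= s) || (s <= r <= 0) -> D (x + r *: e_ i).
Proof.
move=> Dc Dx Ds rs; apply: (Dc x (x + s *: e_ i)) => // j.
rewrite !axis_coord; case: eqP => _; last by rewrite !addr0 lexx.
by case/orP: rs => h; apply/orP; [left|right]; lra.
Qed.

(** When [D] contains a neighbourhood of the point on the axis, restricting the increments to [D]
    changes nothing in the limit, and [partial_in] becomes the ordinary derivative that [MVT]
    requires. *)
Lemma is_derive_axis D g x i (c : R) :
  derivable_in D (g : 'rV[R]_n -> R^o) (x + c *: e_ i) (e_ i) ->
  (\forall t \near c, D (x + t *: e_ i)) ->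
  is_derive c 1 (fun t : R => g (x + t *: e_ i)) (partial_in D i g (x + c *: e_ i)).
Proof.
move=> dg nD.
set df := partial_in _ _ _ _.
have nD1 : \forall s \near (0 : R), D (x + (s + c) *: e_ i).
  have /(_ 0) : continuous (fun s : R => s + c).
    apply: (@lipschitz_continuous _ _ 1) => s t.
    by rewrite mul1r (_ : t + c - (s + c) = t - s) //; ring.
  by rewrite /continuous_at add0r => /(_ _ nD).
have nD0 : \forall s \near (0 : R)^', D (x + c *: e_ i + s *: e_ i).
  apply: nbhs_dnbhs; near=> s.
  have : D (x + (s + c) *: e_ i) by near: s.
  by rewrite scalerDl (addrC (s *: _)) addrA.
have H : s^-1 *: (g (x + (s *: 1 + c) *: e_ i) - g (x + c *: e_ i))
    @[s --> (0 : R)^'] --> (df : R^o).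
  move=> U /dg; rewrite /dquot_in /= /within /= => HU.
  suff : \forall s \near (0 : R)^',
    U (s^-1 *: (g (x + (s *: 1 + c) *: e_ i) - g (x + c *: e_ i))) by [].
  near=> s.
  have -> : x + (s *: 1 + c) *: e_ i = x + c *: e_ i + s *: e_ i.
    by rewrite scalerDl [s *: 1]mulr1 (addrC (s *: _)) addrA.
  have : D (x + c *: e_ i + s *: e_ i) by near: s.
  by near: s.
apply: DeriveDef; first by apply/cvg_ex; exists df; exact: H.
by apply: cvg_lim => //; exact: H.
Unshelve. all: by end_near. Qed.

Lemma within_continuous_axis D g x i (a b : R) :
  {within D, continuous g} ->
  (forall t, a <= t <= b -> D (x + t *: e_ i)) ->
  {within `[a, b]%classic, continuous (fun t : R => g (x + t *: e_ i))}.
Proof.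
move=> /subspace_continuousP cg HD; apply/subspace_continuousP => t.
rewrite /= in_itv /= => tab.
have ct : (fun r : R => x + r *: e_ i) @ t --> x + t *: e_ i.
  by apply: cvgD; [exact: cvg_cst|apply: cvgZr_tmp; exact: cvg_id].
move=> U /(cg _ (HD _ tab)); rewrite /= /within /= => /ct HU.
have {}HU : \forall r \near t, D (x + r *: e_ i) -> U (g (x + r *: e_ i)) by [].
suff : \forall r \near t, (r \in `[a, b]) -> U (g (x + r *: e_ i)) by [].
near=> r; rewrite in_itv /= => rab.
have : D (x + r *: e_ i) by apply: HD.
by near: r.
Unshelve. all: by end_near. Qed.

Lemma mean_value_axis D g i x (s : R) :
  box_convex D -> {within D, continuous g} ->
  (forall y, D y -> derivable_in D (g : 'rV[R]_n -> R^o) y (e_ i)) ->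
  D x -> D (x + s *: e_ i) ->
  exists2 r : R, (0 <= r <= s) || (s <= r <= 0) &
    g (x + s *: e_ i) - g x = partial_in D i g (x + r *: e_ i) * s.
Proof.
move=> Dc cg dg.
have pos y (t : R) : 0 < t -> D y -> D (y + t *: e_ i) -> exists2 r : R, 0 <= r <= t &
    g (y + t *: e_ i) - g y = partial_in D i g (y + r *: e_ i) * t.
  move=> t0 Dy Dt.
  have HD r : 0 <= r <= t -> D (y + r *: e_ i).
    by move=> h; apply: (box_convex_axis (s := t)) => //; rewrite h.
  have [r|//|r] := @MVT R (fun r => g (y + r *: e_ i))
    (fun r => partial_in D i g (y + r *: e_ i)) 0 t t0.
  - rewrite in_itv /= => /andP[r0 rt]; apply: is_derive_axis.
      by apply: dg; apply: HD; rewrite !ltW.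
    near=> q; apply: HD; apply/andP; split; apply: ltW; near: q.
      exact: lt_nbhsr.
    exact: lt_nbhsl.
  - exact: within_continuous_axis.
  rewrite in_itv /= => /andP[r0 rt]; rewrite scale0r addr0 subr0 => E.
  by exists r => //; rewrite !ltW.
move=> Dx Ds; case: (ltgtP s 0) => [s0|s0|->].
- have [||r rs E] := pos (x + s *: e_ i) (- s) _ Ds; first by rewrite oppr_gt0.
    by rewrite scaleNr addrK.
  exists (s + r); first by apply/orP; right; lra.
  move: E; rewrite scaleNr addrK scalerDl addrA => E.
  by rewrite -opprB E mulrN opprK.
- have [r rs E] := pos x s s0 Dx Ds.
  by exists r => //; rewrite rs.
- by exists 0; [rewrite lexx|rewrite scale0r addr0 subrr mulr0].
Unshelve. all: by end_near. Qed.

(** A staircase [z] from [x] to [y] changes one coordinate per step; each step has its own mean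
    value point and the increments of [g] telescope. The distance bound on these points is what a
    Taylor estimate needs. *)
Lemma mean_value_rV D g : box_convex D -> {within D, continuous g} ->
  (forall i y, D y -> derivable_in D (g : 'rV[R]_n -> R^o) y (e_ i)) ->
  forall x y, D x -> D y -> exists xi : 'I_n -> 'rV[R]_n,
    (forall i, D (xi i) /\ `|xi i - x| <= `|y - x|) /\
    g y - g x = \sum_i partial_in D i g (xi i) * (y 0 i - x 0 i).
Proof.
move=> Dc cg dg x y Dx Dy.
pose z (m : nat) : 'rV[R]_n := \row_i (if (i < m)%N then y 0 i else x 0 i).
have Dz m : D (z m).
  apply: (Dc x y) => // i; rewrite !mxE; case: ifP => _; rewrite !lexx ?andbT /=;
    exact: le_total.
have zS (i : 'I_n) : z i.+1 = z i + (y 0 i - x 0 i) *: e_ i.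
  apply/rowP => j; rewrite axis_coord !mxE ltnS leq_eqVlt.
  have [->|ji] /= := eqVneq j i; first by rewrite eqxx ltnn /= addrC subrK.
  by rewrite val_eqE (negbTE ji) /= addr0.
have H (i : 'I_n) : exists w, (D w /\ `|w - x| <= `|y - x|) /\
    g (z i.+1) - g (z i) = partial_in D i g w * (y 0 i - x 0 i).
  have [||r rs E] := @mean_value_axis D g i (z i) (y 0 i - x 0 i) Dc cg (dg i).
  - exact: Dz.
  - by rewrite -zS.
  exists (z i + r *: e_ i); split; last by rewrite zS.
  split.
    by apply: box_convex_axis rs => //; rewrite -zS.
  apply: rV_norm_leP => // j; apply: le_trans (rV_coordB_le y x j).
  rewrite [X in `|X|]mxE axis_coord !mxE.
  have [->|ji] := eqVneq j i.
    rewrite ltnn; have -> : x 0 i + r - x 0 i = r by ring.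
    by case/orP: rs => h; [rewrite ger0_norm ?ger0_norm|rewrite ler0_norm ?ler0_norm]; lra.
  rewrite addr0; case: ifP => // _; first by rewrite subrr normr0.
have [xi Hxi] := choice H; exists xi; split; first by move=> i; case: (Hxi i).
have -> : y = z n by apply/rowP => i; rewrite mxE ltn_ord.
have -> : x = z 0%N by apply/rowP => i; rewrite mxE ltn0.
rewrite -(@telescope_sumr _ 0 n (fun m => g (z m))) // big_mkord.
apply: eq_bigr => i _; case: (Hxi i) => _ ->.
by rewrite !mxE ltn_ord ltn0.
Qed.

End mean_value.

(** * Second order bounds and the perturbed gradient *)

Section second_order_bounds.
Context {R : realType} {n : nat}.
Implicit Types (D : set 'rV[R]_n) (g : 'rV[R]_n -> R).

(** The gradient enters as an independent family [gd], so that the dynamics rest on these four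
    estimates alone and never unfold [derive_in]. *)
Definition C2_bounds D g (gd : 'I_n -> 'rV[R]_n -> R) (N : R) :=
  [/\ forall x y, D x -> D y -> `|g y - g x| <= N * `|y - x|,
      forall i x, D x -> `|gd i x| <= N,
      forall i x y, D x -> D y -> `|gd i y - gd i x| <= N * `|y - x| &
      forall x y, D x -> D y ->
        `|g y - g x - \sum_i gd i x * (y 0 i - x 0 i)| <= N * `|y - x| ^+ 2].

Lemma lipschitz_of_partials D g (B : R) : box_convex D ->
  {within D, continuous g} ->
  (forall i y, D y -> derivable_in D (g : 'rV[R]_n -> R^o) y (delta_mx 0 i)) ->
  (forall i x, D x -> `|partial_in D i g x| <= B) ->
  forall x y, D x -> D y -> `|g y - g x| <= n%:R * B * `|y - x|.
Proof.
move=> Dc cg dg gB x y Dx Dy.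
have [xi [Hxi ->]] := mean_value_rV Dc cg dg Dx Dy.
apply: le_trans (ler_norm_sum _ _ _) _.
apply: (@le_trans _ _ (\sum_(i < n) B * `|y - x|)).
  apply: ler_sum => i _; rewrite normrM ler_pM //; last exact: rV_coordB_le.
  by apply: gB; case: (Hxi i).
by rewrite sumr_const card_ord -[leLHS]mulr_natl mulrA.
Qed.

Lemma is_Cr_C2_bounds D r g (B : R) : box_convex D -> is_Cr D r g -> (2 <= r)%N ->
  0 <= B ->
  (forall i x, D x -> `|partial_in D i g x| <= B) ->
  (forall i j x, D x -> `|partial_in D i (partial_in D j g) x| <= B) ->
  exists2 N : R, 0 < N & C2_bounds D g (fun i => partial_in D i g) N.
Proof.
move=> Dc [cg dg] r2 B0 B1 B2.
have cg0 := cg [::] (leq0n _).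
have dg0 i y Dy := dg [::] i (leq_trans (ltn0Sn _) r2) y Dy.
have cg1 i := cg [:: i] (leq_trans (ltn0Sn _) r2).
have dg1 i j y Dy := dg [:: j] i r2 y Dy.
have lip := lipschitz_of_partials Dc cg0 dg0 B1.
have lip1 j := lipschitz_of_partials Dc (cg1 j) (fun i => @dg1 i j)
  (fun i => B2 i j).
set nB : R := n%:R * B; have nB0 : 0 <= nB by rewrite mulr_ge0.
have nnB0 : 0 <= n%:R * nB by rewrite mulr_ge0.
exists (nB + B + n%:R * nB + 1); first by lra.
split.
- move=> x y Dx Dy; apply: le_trans (lip _ _ Dx Dy) _.
  by rewrite ler_wpM2r // -/nB; lra.
- by move=> i x Dx; apply: le_trans (B1 _ _ Dx) _; lra.
- move=> i x y Dx Dy; apply: le_trans (lip1 _ _ _ Dx Dy) _.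
  by rewrite ler_wpM2r // -/nB; lra.
move=> x y Dx Dy.
(* The points [xi i] are within [|y - x|] of [x], so the Lipschitz bound on the partial derivatives
   turns the mean value formula into a Taylor estimate. *)
have [xi [Hxi ->]] := mean_value_rV Dc cg0 dg0 Dx Dy.
rewrite -sumrB; apply: le_trans (ler_norm_sum _ _ _) _.
apply: (@le_trans _ _ (\sum_(i < n) nB * `|y - x| ^+ 2)).
  apply: ler_sum => i _; rewrite -mulrBl normrM expr2 mulrA.
  apply: ler_pM => //; last exact: rV_coordB_le.
  case: (Hxi i) => Di hi; apply: le_trans (lip1 _ _ _ Dx Di) _.
  by rewrite ler_wpM2l.
rewrite sumr_const card_ord -[leLHS]mulr_natl mulrA ler_wpM2r ?sqr_ge0 //; lra.
Qed.

Lemma finite_bound (T : finType) (G : T -> 'rV[R]_n -> R) D :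
  (forall i, exists B, forall x, D x -> `|G i x| <= B) ->
  exists2 B, 0 <= B & forall i x, D x -> `|G i x| <= B.
Proof.
move=> /choice[b Hb]; exists (\sum_i `|b i|); first exact: sumr_ge0.
move=> i x Dx; apply: le_trans (Hb i x Dx) _; apply: le_trans (ler_norm _) _.
by rewrite (bigD1 i) //= lerDl sumr_ge0.
Qed.

Lemma box_bounded (a b : 'I_n -> R) D g :
  (forall x : 'rV[R]_n, (forall i, a i <= x 0 i <= b i) -> D x) ->
  {within D, continuous g} ->
  exists B, forall x : 'rV[R]_n, (forall i, a i <= x 0 i <= b i) -> `|g x| <= B.
Proof.
move=> AD cg.
pose A : set 'rV[R]_n := [set v | forall i, (`[a i, b i]%classic : set R) (v ord0 i)].
have cA : compact A.
  apply: (@rV_compact R n (fun i => `[a i, b i]%classic)) => i.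
  exact: segment_compact.
have cgA : {within A, continuous g}.
  apply: continuous_subspaceW cg => v Av; apply: AD => i.
  by have := Av i; rewrite /= in_itv.
have [M [_ HM]] := compact_bounded (continuous_compact cgA cA).
exists (M + 1) => x Hx; apply: (HM (M + 1)); first by rewrite ltrDl.
by exists x => // i; rewrite /= in_itv /=; exact: Hx.
Qed.

(** The multi-index zero. Applied to [f], this makes the energy estimate uniform in [f]. *)
Lemma Cr_unit_ball_le1 D r g x : Cr_unit_ball D r g -> D x -> `|g x| <= 1.
Proof.
move=> [_ H] Dx; rewrite -lee_fin; apply: le_trans H.
apply: ereal_sup_ubound; exists [ffun=> 0%N], x; split => //.
  by rewrite big1 // => i _; rewrite ffunE.
rewrite /multi_partial (_ : flatten _ = [::]) //.
by elim: (enum _) => //= i s ->; rewrite ffunE.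
Qed.

End second_order_bounds.

Section phase_space_bounds.
Context {R : realType} (rho : R).
Local Notation B := (action_box rho).
Local Notation P := (phase_space rho).

Lemma action_boxP (I : 'rV[R]_2) : B I <-> forall i, - rho <= I 0 i <= rho.
Proof.
split=> [[h0 h1] i|H]; last by split; rewrite ler_norml; apply: H.
rewrite -ler_norml; case: i => -[|[|//]] hi.
  by rewrite (_ : Ordinal _ = 0) //; apply/val_inj.
by rewrite (_ : Ordinal _ = 1) //; apply/val_inj.
Qed.

Lemma action_box_convex : box_convex B.
Proof.
move=> x y z /action_boxP Bx /action_boxP By H; apply/action_boxP => i.
by have := Bx i; have := By i; case/orP: (H i); lra.
Qed.

Lemma phase_space_convex : box_convex P.
Proof.
move=> x y z Px Py H; apply: (action_box_convex Px Py) => i.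
by rewrite !mxE; exact: H.
Qed.

Lemma action_C2_bounds r h : is_Cr B r h -> (2 <= r)%N ->
  exists2 N : R, 0 < N & C2_bounds B h (fun i => partial_in B i h) N.
Proof.
move=> Ch r2.
have bnd (g : 'rV[R]_2 -> R) : {within B, continuous g} -> exists M, forall x, B x -> `|g x| <= M.
  move=> cg; have [|M HM] := @box_bounded _ _ (fun=> - rho) (fun=> rho) _ g _ cg.
    by move=> x Hx; apply/action_boxP.
  by exists M => x /action_boxP; exact: HM.
case: (Ch) => cg _.
have [M1 M10 H1] : exists2 M, 0 <= M &
    forall i x, B x -> `|partial_in B i h x| <= M.
  by apply: finite_bound => i; apply/bnd/(cg [:: i]); exact: leq_trans r2.
have [M2 M20 H2] : exists2 M, 0 <= M &
    forall (ij : 'I_2 * 'I_2) x, B x ->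
      `|partial_in B ij.1 (partial_in B ij.2 h) x| <= M.
  by apply: finite_bound => ij; apply/bnd/(cg [:: ij.1; ij.2]).
apply: (@is_Cr_C2_bounds _ _ _ r _ (M1 + M2)) => //.
- exact: action_box_convex.
- by rewrite addr_ge0.
- by move=> i x Bx; apply: le_trans (H1 _ _ Bx) _; lra.
- by move=> i j x Bx; apply: le_trans (H2 (i, j) _ Bx) _; lra.
Qed.

(** Integer translations preserve [P], so the difference quotients at the two points coincide as
    filters; their [lim] then agree without any discussion of existence. *)
Lemma torus_periodic_partial g i :
  torus_periodic rho g -> torus_periodic rho (partial_in P i g).
Proof.
move=> pg theta I m BI.
rewrite /partial_in /derive_in; congr lim; apply/funext => U.
set x := row_mx theta I; set x' := row_mx _ I.
have E y : x' + y = row_mx (lsubmx (x + y) + map_mx intr m) (rsubmx (x + y)).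
  rewrite -[in LHS](hsubmxK y) !add_row_mx.
  by rewrite -[in RHS](hsubmxK y) !add_row_mx row_mxKl row_mxKr addrAC.
have gE y : P (x + y) -> g (x' + y) = g (x + y).
  by move=> Py; rewrite E pg // hsubmxK.
have PE y : P (x' + y) = P (x + y) by rewrite E /phase_space /= row_mxKr.
have gx : g x' = g x by rewrite /x' pg.
rewrite /dquot_in /= /within /= gx; congr ((0 : R)^' _).
apply/funext => s; apply/propext; split=> H h; [move: H|move: H].
- by rewrite /= PE => /(_ h); rewrite gE.
- by rewrite /= PE in h; move=> /(_ h); rewrite /= gE.
Qed.

(** [P] is not compact, its angles ranging over the universal cover; subtracting integer parts
    brings them into [[0, 1]], where compactness applies. *)
Lemma phase_bounded (g : 'rV[R]_(2 + 2) -> R) : torus_periodic rho g -> {within P, continuous g} ->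
  exists M, forall x, P x -> `|g x| <= M.
Proof.
move=> pg cg.
pose a (i : 'I_(2 + 2)) : R := if (i < 2)%N then 0 else - rho.
pose b (i : 'I_(2 + 2)) : R := if (i < 2)%N then 1 else rho.
have [|M HM] := @box_bounded _ _ a b _ _ _ cg.
  move=> x Hx; apply/action_boxP => i; rewrite mxE.
  by have := Hx (rshift 2 i); rewrite /a /b.
exists M => x Px; rewrite -[x]hsubmxK.
pose m : 'rV[int]_2 := \row_i - Num.floor (lsubmx x 0 i).
rewrite -(pg _ _ m) //; apply: HM => i.
rewrite /a /b -(splitK i); case: (fintype.split i) => j /=.
  rewrite ltn_ord row_mxEl !mxE rmorphN /=.
  have := floor_le (x 0 (lshift 2 j)); have := floorD1_gt (x 0 (lshift 2 j)).
  by rewrite rmorphD /=; lra.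
by rewrite row_mxEr; move: Px => /action_boxP/(_ j).
Qed.

Lemma phase_C2_bounds r f : torus_periodic rho f -> is_Cr P r f -> (2 <= r)%N ->
  exists2 N : R, 0 < N & C2_bounds P f (fun i => partial_in P i f) N.
Proof.
move=> pf Cf r2; case: (Cf) => cg _.
have [M1 M10 H1] : exists2 M, 0 <= M &
    forall i x, P x -> `|partial_in P i f x| <= M.
  apply: finite_bound => i; apply: phase_bounded.
    exact: torus_periodic_partial.
  by apply: (cg [:: i]); exact: leq_trans r2.
have [M2 M20 H2] : exists2 M, 0 <= M &
    forall (ij : 'I_(2 + 2) * 'I_(2 + 2)) x, P x ->
      `|partial_in P ij.1 (partial_in P ij.2 f) x| <= M.
  apply: finite_bound => ij; apply: phase_bounded; last exact: (cg [:: ij.1; ij.2]).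
  exact/torus_periodic_partial/torus_periodic_partial.
apply: (@is_Cr_C2_bounds _ _ _ r _ (M1 + M2)) => //.
- exact: phase_space_convex.
- by rewrite addr_ge0.
- by move=> i x Bx; apply: le_trans (H1 _ _ Bx) _; lra.
- by move=> i j x Bx; apply: le_trans (H2 (i, j) _ Bx) _; lra.
Qed.

End phase_space_bounds.

Section gradient_of_perturbed.
Context {R : realType} (rho : R).
Hypothesis rho0 : 0 < rho.
Local Notation B := (action_box rho).
Local Notation P := (phase_space rho).

(** Uniqueness of the limit defining [derive_in] needs admissible increments arbitrarily close to 0;
    [0 < rho] provides them even on a face. *)
Lemma phase_space_proper x (j : 'I_(2 + 2)) : P x ->
  ProperFilter (within [set s : R | P (x + s *: delta_mx 0 j)] (0 : R)^').
Proof.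
move=> Px.
have [sg [sg1 Hs]] : exists sg : R, `|sg| = 1 /\
    forall s, 0 < s -> s <= rho -> P (x + (sg * s) *: delta_mx 0 j).
  (* Moving an action coordinate towards zero and past it keeps it in [[- rho, rho]] for steps up to
     [rho]; an angle is unconstrained. *)
  have [x0|x0] := leP (x 0 j) 0.
    exists 1; rewrite normr1; split=> // s s0 sr; apply/action_boxP => i.
    rewrite mxE axis_coord mul1r; have := proj1 (action_boxP rho _) Px i.
    by rewrite mxE; case: eqP => [->|_]; lra.
  exists (-1); rewrite normrN1; split=> // s s0 sr; apply/action_boxP => i.
  rewrite mxE axis_coord mulN1r; have := proj1 (action_boxP rho _) Px i.
  by rewrite mxE; case: eqP => [->|_]; lra.
apply: Build_ProperFilter_ex => A.
rewrite /within /= => /nbhs_ballP[e /= e0 HA].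
pose s := Num.min rho (e / 2).
have s0 : 0 < s by rewrite lt_min rho0 divr_gt0.
have se : s < e by rewrite gt_min; apply/orP; right; lra.
have sr : s <= rho by rewrite ge_min lexx.
have sn : `|sg * s| = s by rewrite normrM sg1 mul1r gtr0_norm.
exists (sg * s); apply: HA => //; last exact: Hs.
  by rewrite /ball /= sub0r normrN sn.
by rewrite -normr_gt0 sn.
Qed.

Lemma is_derive_in_partial x j (g : 'rV[R]_(2 + 2) -> R) (d : R) : P x ->
  is_derive_in P (g : _ -> R^o) x (delta_mx 0 j) (d : R^o) ->
  partial_in P j g x = d.
Proof.
move=> Px H; have PF := phase_space_proper j Px.
by apply: cvg_lim => //; exact: H.
Qed.

Lemma is_derive_in_perturbed h f eps x j (a b : R) :
  is_derive_in P ((fun y => h (rsubmx y)) : _ -> R^o) x (delta_mx 0 j) (a : R^o) ->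
  is_derive_in P (f : _ -> R^o) x (delta_mx 0 j) (b : R^o) ->
  is_derive_in P (perturbed h eps f : _ -> R^o) x (delta_mx 0 j)
    ((a + eps * b) : R^o).
Proof.
move=> Ha Hb; rewrite /is_derive_in /dquot_in.
set q := (fun s : R => _ *: _).
have -> : q = (fun s : R => (s^-1 *: (h (rsubmx (x + s *: delta_mx 0 j)) - h (rsubmx x) : R^o)
    + eps *: (s^-1 *: (f (x + s *: delta_mx 0 j) - f x : R^o)))).
  by apply/funext => s; rewrite /q /perturbed /GRing.scale /=; ring.
exact: cvgD Ha (cvgZl_tmp (k := eps) Hb).
Qed.

Lemma partial_perturbed_theta h f eps x (i : 'I_2) : P x ->
  derivable_in P (f : _ -> R^o) x (delta_mx 0 (lshift 2 i)) ->
  partial_in P (lshift 2 i) (perturbed h eps f) x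
    = eps * partial_in P (lshift 2 i) f x.
Proof.
move=> Px df; rewrite -[RHS]add0r; apply: is_derive_in_partial => //.
apply: is_derive_in_perturbed; last exact: df.
rewrite /is_derive_in /dquot_in.
set q := (fun s : R => _ *: _); rewrite (_ : q = fun=> 0); first exact: cvg_cst.
apply/funext => s; rewrite /q.
rewrite (_ : rsubmx (x + _) = rsubmx x) ?subrr ?scaler0 //.
apply/rowP => l; rewrite mxE axis_coord mxE.
by rewrite (_ : (rshift 2 l == lshift 2 i) = false) ?addr0 // eq_rlshift.
Qed.

Lemma partial_perturbed_I h f eps x (i : 'I_2) : P x ->
  derivable_in B (h : _ -> R^o) (rsubmx x) (delta_mx 0 i) ->
  derivable_in P (f : _ -> R^o) x (delta_mx 0 (rshift 2 i)) ->
  partial_in P (rshift 2 i) (perturbed h eps f) x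
    = partial_in B i h (rsubmx x) + eps * partial_in P (rshift 2 i) f x.
Proof.
move=> Px dh df; apply: is_derive_in_partial => //.
apply: is_derive_in_perturbed; last exact: df.
have E s : rsubmx (x + s *: delta_mx 0 (rshift 2 i)) = rsubmx x + s *: delta_mx 0 i.
  by apply/rowP => l; rewrite mxE !axis_coord mxE eq_rshift.
have EP : [set s : R | P (x + s *: delta_mx 0 (rshift 2 i))] =
    [set s : R | B (rsubmx x + s *: delta_mx 0 i)].
  by apply/seteqP; split => s; rewrite /phase_space /= E.
have Eq : (fun s : R => s^-1 *: (h (rsubmx (x + s *: delta_mx 0 (rshift 2 i)))
      - h (rsubmx x) : R^o)) =
    (fun s : R => s^-1 *: (h (rsubmx x + s *: delta_mx 0 i) - h (rsubmx x) : R^o)).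
  by apply/funext => s; rewrite E.
by rewrite /is_derive_in /dquot_in EP Eq; exact: dh.
Qed.

End gradient_of_perturbed.

(** * Resonant segments *)

Lemma ord2P (i : 'I_2) : i = 0 \/ i = 1.
Proof. by case: i => -[|[|//]] hi; [left|right]; exact/val_inj. Qed.

Lemma sum_ord2 {R : realType} (F : 'I_2 -> R) : \sum_i F i = F 0 + F 1.
Proof.
rewrite big_ord_recl big_ord1; congr (_ + F _); exact/val_inj.
Qed.

Lemma rV2P {R : realType} (x y : 'rV[R]_2) :
  x 0 0 = y 0 0 -> x 0 1 = y 0 1 -> x = y.
Proof. by move=> h0 h1; apply/rowP => i; case: (ord2P i) => ->. Qed.

Lemma rV2_norm_le {R : realType} (x : 'rV[R]_2) (M : R) :
  `|x 0 0| <= M -> `|x 0 1| <= M -> `|x| <= M.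
Proof.
move=> h0 h1; apply: rV_norm_leP; first exact: le_trans h0.
by move=> i; case: (ord2P i) => ->.
Qed.

Section clamp.
Context {R : realType}.
Implicit Types lo hi t : R.

Definition clamp lo hi t : R := Num.max lo (Num.min hi t).

Lemma clamp_id lo hi t : lo <= t <= hi -> clamp lo hi t = t.
Proof. by move=> /andP[lt th]; rewrite /clamp min_r // max_r. Qed.

Lemma clamp_itv lo hi t : lo <= hi -> lo <= clamp lo hi t <= hi.
Proof. by move=> lh; rewrite /clamp le_max lexx /= ge_max lh ge_min lexx. Qed.

Lemma clamp_lipschitz lo hi s t : `|clamp lo hi t - clamp lo hi s| <= `|t - s|.
Proof.
rewrite /clamp ler_norml; have := ler_norm (t - s); have := ler_norm (- (t - s)).
have := normr_ge0 (t - s); rewrite normrN => h0 h1 h2.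
have [ht|ht] := leP hi t; have [hs|hs] := leP hi s;
have [l1|l1] := leP lo hi; have [l2|l2] := leP lo t; have [l3|l3] := leP lo s; lra.
Qed.

End clamp.

Section resonant_segment.
Context {R : realType} (rho : R) (h : 'rV[R]_2 -> R) (hd : 'I_2 -> 'rV[R]_2 -> R).
Variables (N k0 k1 a : R) (p q : 'rV[R]_2).
Hypothesis N0 : 0 < N.
Hypothesis hC2 : C2_bounds (action_box rho) h hd N.
Hypothesis kappa0 : 0 < k0 ^+ 2 + k1 ^+ 2.
Hypothesis S_line : forall x, segment p q x -> k0 * x 0 0 + k1 * x 0 1 + a = 0.
Hypothesis S_box : forall x, segment p q x -> action_box rho x.
Hypothesis h_cst : forall x y, segment p q x -> segment p q y -> h x = h y.
Hypothesis pq : p <> q.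
Local Notation S := (segment p q).
Local Notation B := (action_box rho).
Let kappa := k0 ^+ 2 + k1 ^+ 2.
Let Q : R := `|k0| + `|k1|.
Let u : 'rV[R]_2 := q - p.

Let point t : 'rV[R]_2 := (1 - t) *: p + t *: q.

Lemma segment_point t : 0 <= t <= 1 -> S (point t).
Proof. by move=> t01; exists t => //=; rewrite in_itv. Qed.

Lemma pointE t i : point t 0 i = p 0 i + t * u 0 i.
Proof. by rewrite !mxE; ring. Qed.

Lemma dir_line : k0 * u 0 0 + k1 * u 0 1 = 0.
Proof.
have := S_line (@segment_point 0 _); have := S_line (@segment_point 1 _).
rewrite !pointE; move=> /(_ ltac:(lra)) h1 /(_ ltac:(lra)) h0; lra.
Qed.

Lemma dir_neq0 : 0 < u 0 0 ^+ 2 + u 0 1 ^+ 2.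
Proof.
rewrite lt_def addr_ge0 ?sqr_ge0 // andbT paddr_eq0 ?sqr_ge0 // !sqrf_eq0.
apply/negP => /andP[/eqP u0 /eqP u1]; apply: pq; apply: rV2P.
- by move: u0; rewrite !mxE; lra.
- by move: u1; rewrite !mxE; lra.
Qed.

(* [u] spans the orthogonal of [k]. *)
Lemma orth_collinear (w0 w1 : R) : w0 * u 0 0 + w1 * u 0 1 = 0 ->
  k0 * w1 - k1 * w0 = 0.
Proof.
move=> hw; have hk := dir_line; have hu := dir_neq0.
apply/eqP; have : (k0 * w1 - k1 * w0) * (u 0 0 ^+ 2 + u 0 1 ^+ 2) == 0.
  apply/eqP.
  have -> : (k0 * w1 - k1 * w0) * (u 0 0 ^+ 2 + u 0 1 ^+ 2) =
    (k0 * u 0 0 + k1 * u 0 1) * (w1 * u 0 0 - w0 * u 0 1)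
    + (w0 * u 0 0 + w1 * u 0 1) * (k0 * u 0 1 - k1 * u 0 0) by ring.
  by rewrite hw hk; ring.
by rewrite mulf_eq0 (gt_eqF hu) orbF.
Qed.

(** As [h] is constant along [u], its gradient is orthogonal to [u], hence parallel to [k]. At an
    end of the segment only one direction along [u] is available, whence the sign [sg]. *)
Lemma segment_tangential y : S y -> k0 * hd 1 y - k1 * hd 0 y = 0.
Proof.
move=> Sy; apply: orth_collinear; case: (Sy) => t /=; rewrite in_itv /= => t01 yE.
have [_ _ _ taylor] := hC2.
have [sg sg1 Hs] : exists2 sg : R, `|sg| = 1 &
    forall s, 0 <= s -> s <= 1 / 2 -> 0 <= t + sg * s <= 1.
  have [t2|t2] := leP t (1 / 2).
    by exists 1; [rewrite normr1|move=> s s0 s1; lra].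
  by exists (-1); [rewrite normrN1|move=> s s0 s1; lra].
set c := hd 0 y * u 0 0 + hd 1 y * u 0 1.
apply/eqP; rewrite -normr_le0.
apply: (@le_add_geometric _ _ _ (2^-1 * (N * `|u| ^+ 2))) => m; rewrite add0r.
(* Dividing the Taylor estimate for a step [s] by [s] bounds the derivative along [u] by
   [s * N * |u| ^+ 2], for dyadic [s] as small as desired. *)
pose s : R := 2^-1 * 2^-1 ^+ m.
have s0 : 0 < s by rewrite mulr_gt0 // exprn_gt0.
have s1 : s <= 1 / 2.
  have : 2^-1 ^+ m <= 1 :> R by apply: exprn_ile1; lra.
  by rewrite /s; lra.
have Sz := segment_point (Hs _ (ltW s0) s1); set z := point _ in Sz.
have zy : z = y + (sg * s) *: u.
  by rewrite -yE; apply/rowP => i; rewrite !mxE; ring.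
have := taylor y z (S_box Sy) (S_box Sz).
rewrite (h_cst Sz Sy) subrr sum_ord2 sub0r normrN.
have -> : z 0 0 - y 0 0 = sg * s * u 0 0 by rewrite zy !mxE; ring.
have -> : z 0 1 - y 0 1 = sg * s * u 0 1 by rewrite zy !mxE; ring.
have -> : z - y = (sg * s) *: u by rewrite zy addrC addKr.
have -> : hd 0 y * (sg * s * u 0 0) + hd 1 y * (sg * s * u 0 1) = sg * s * c.
  by rewrite /c; ring.
have sgs : `|sg * s| = s by rewrite normrM sg1 mul1r gtr0_norm.
have sgc : `|sg * s * c| = s * `|c| by rewrite normrM sgs.
rewrite sgc normrZ sgs.
have -> : N * (s * `|u|) ^+ 2 = s * (s * (N * `|u| ^+ 2)) by ring.
rewrite ler_pM2l // => hh; apply: le_trans hh _.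
by rewrite le_eqVlt; apply/orP; left; apply/eqP; rewrite /s; ring.
Qed.

(** Compactness of the segment. The component of [grad h] along [k] cannot vanish, since the
    orthogonal one already does. Clamping the parameter extends it to a Lipschitz function on the
    whole line. *)
Lemma segment_transverse_min :
  (forall x, S x -> hd 0 x <> 0 \/ hd 1 x <> 0) ->
  exists2 lam : R, 0 < lam & forall y, S y -> lam <= `|k0 * hd 0 y + k1 * hd 1 y|.
Proof.
move=> nz; have [_ _ hlip _] := hC2.
pose c t := point (clamp 0 1 t).
have Sc t : S (c t) by apply: segment_point; exact: clamp_itv.
pose v (t : R) : R := `|k0 * hd 0 (c t) + k1 * hd 1 (c t)|.
have cv : continuous v.
  apply: (@lipschitz_continuous _ _ (Q * (N * `|u|))) => s t.
  apply: le_trans (ler_dist_dist _ _) _.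
  have hl i : `|hd i (c t) - hd i (c s)| <= N * `|u| * `|t - s|.
    apply: le_trans (hlip i _ _ (S_box (Sc s)) (S_box (Sc t))) _.
    have -> : c t - c s = (clamp 0 1 t - clamp 0 1 s) *: u.
      by apply/rowP => j; rewrite !mxE; ring.
    rewrite normrZ -mulrA ler_wpM2l ?(ltW N0) // mulrC ler_wpM2l //.
    exact: clamp_lipschitz.
  have -> : k0 * hd 0 (c t) + k1 * hd 1 (c t) - (k0 * hd 0 (c s) + k1 * hd 1 (c s))
    = k0 * (hd 0 (c t) - hd 0 (c s)) + k1 * (hd 1 (c t) - hd 1 (c s)) by ring.
  apply: le_trans (ler_normD _ _) _; rewrite !normrM.
  have := ler_wpM2l (normr_ge0 k0) (hl 0); have := ler_wpM2l (normr_ge0 k1) (hl 1).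
  by rewrite /Q; lra.
have cv01 : {within `[0, 1]%classic, continuous v} by exact: continuous_subspaceT.
have [t0 _ Hmin] := EVT_min ler01 cv01.
exists (v t0).
  rewrite normr_gt0; apply/eqP => e0.
  have e1 := segment_tangential (Sc t0).
  have kk : forall w : R, kappa * w = 0 -> w = 0.
    by move=> w /eqP; rewrite mulf_eq0 (gt_eqF kappa0) => /eqP.
  case: (nz _ (Sc t0)); apply; apply: kk.
    have -> : kappa * hd 0 (c t0) = k0 * (k0 * hd 0 (c t0) + k1 * hd 1 (c t0))
      - k1 * (k0 * hd 1 (c t0) - k1 * hd 0 (c t0)) by rewrite /kappa; ring.
    by rewrite e0 e1; ring.
  have -> : kappa * hd 1 (c t0) = k1 * (k0 * hd 0 (c t0) + k1 * hd 1 (c t0))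
    + k0 * (k0 * hd 1 (c t0) - k1 * hd 0 (c t0)) by rewrite /kappa; ring.
  by rewrite e0 e1; ring.
move=> y [t /= t01 yE]; have := Hmin t t01.
rewrite /v /c (@clamp_id _ _ _ t); last by move: t01; rewrite in_itv.
by rewrite /point yE.
Qed.

(** On the line, [y - Is] is a multiple [b] of [u], read off by projection; [r] is chosen so that
    [|b| <= min(t, 1 - t)], which keeps the parameter [t + b] in [[0, 1]]. *)
Lemma segment_int_nbhs Is : segment_int p q Is -> exists2 r : R, 0 < r &
  forall y : 'rV[R]_2, k0 * y 0 0 + k1 * y 0 1 + a = 0 -> `|y - Is| <= r -> S y.
Proof.
move=> [[t /= t01 IsE] nend]; rewrite in_itv /= in t01.
have {IsE}IsE : Is = point t by rewrite -IsE.
have t0 : 0 < t.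
  rewrite lt_def; case/andP: t01 => -> _; rewrite andbT.
  apply/eqP => t0; apply: nend; left.
  by rewrite IsE; apply/rowP => i; rewrite pointE t0; ring.
have t1 : t < 1.
  rewrite lt_def; case/andP: t01 => _ ->; rewrite andbT.
  apply/eqP => t1; apply: nend; right.
  by rewrite IsE; apply/rowP => i; rewrite pointE -t1 !mxE; ring.
pose U := u 0 0 ^+ 2 + u 0 1 ^+ 2; have U0 : 0 < U := dir_neq0.
pose d := Num.min t (1 - t); have d0 : 0 < d by rewrite lt_min t0 subr_gt0.
have dt : d <= t by rewrite ge_min lexx.
have d1 : d <= 1 - t by rewrite ge_min lexx orbT.
pose W : R := `|u 0 0| + `|u 0 1| + 1.
have W0 : 0 < W by rewrite /W; have := normr_ge0 (u 0 0); have := normr_ge0 (u 0 1); lra.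
exists (d * U / W); first by rewrite divr_gt0 // mulr_gt0.
move=> y yL yr; pose w := y - Is.
have wE i : w 0 i = y 0 i - Is 0 i by rewrite !mxE.
have wk : k0 * w 0 0 + k1 * w 0 1 = 0.
  by rewrite !wE; have := S_line (segment_point t01); rewrite -IsE; lra.
pose b := (w 0 0 * u 0 0 + w 0 1 * u 0 1) / U.
have uk := dir_line.
have wu : w 0 0 * u 0 1 - w 0 1 * u 0 0 = 0.
  apply/eqP; have : (w 0 0 * u 0 1 - w 0 1 * u 0 0) * kappa == 0.
    have -> : (w 0 0 * u 0 1 - w 0 1 * u 0 0) * kappa =
      (k0 * w 0 0 + k1 * w 0 1) * (k0 * u 0 1 - k1 * u 0 0)
      - (k0 * u 0 0 + k1 * u 0 1) * (k0 * w 0 1 - k1 * w 0 0).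
      by rewrite /kappa; ring.
    by rewrite wk uk; apply/eqP; ring.
  by rewrite mulf_eq0 (gt_eqF kappa0) orbF.
have bd : `|b| <= d.
  rewrite /b normrM normfV (gtr0_norm U0) ler_pdivrMr //.
  apply: le_trans (ler_normD _ _) _; rewrite !normrM.
  have h0 := rV_coord_le w 0; have h1 := rV_coord_le w 1.
  have := ler_wpM2r (normr_ge0 (u 0 0)) h0; have := ler_wpM2r (normr_ge0 (u 0 1)) h1.
  move: yr; rewrite ler_pdivlMr // -/w /W; have := normr_ge0 w; lra.
have -> : y = point (t + b).
  have e i : y 0 i = Is 0 i + w 0 i by rewrite wE; ring.
  apply: rV2P; rewrite e IsE !pointE mulrDl addrA; congr (_ + _).
    rewrite -[LHS](mulfK (lt0r_neq0 U0)) /b [RHS]mulrAC; congr (_ / _).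
    have -> : w 0 0 * U = (w 0 0 * u 0 0 + w 0 1 * u 0 1) * u 0 0
      + (w 0 0 * u 0 1 - w 0 1 * u 0 0) * u 0 1 by rewrite /U; ring.
    by rewrite wu mul0r addr0.
  rewrite -[LHS](mulfK (lt0r_neq0 U0)) /b [RHS]mulrAC; congr (_ / _).
  have -> : w 0 1 * U = (w 0 0 * u 0 0 + w 0 1 * u 0 1) * u 0 1
    - (w 0 0 * u 0 1 - w 0 1 * u 0 0) * u 0 0 by rewrite /U; ring.
  by rewrite wu mul0r subr0.
apply: segment_point; move: bd; rewrite ler_norml; lra.
Qed.

(** Here [y = I - sigma * k] is the orthogonal projection of [I] on the resonant line. As
    [h y = h Is], Taylor at [y] gives [h I - h Is = sigma * (k . grad h y) + O(sigma ^+ 2)], whose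
    linear part is at least [|sigma| * lam]. *)
Lemma energy_controls_distance (lam : R) Is : 0 < lam ->
  (forall y, S y -> lam <= `|k0 * hd 0 y + k1 * hd 1 y|) ->
  segment_int p q Is -> exists2 r : R, 0 < r &
  forall I : 'rV[R]_2, B I -> `|I - Is| <= r ->
    let sigma := (k0 * I 0 0 + k1 * I 0 1 + a) / kappa in
    exists y, [/\ S y, `|I - y| <= Q * `|sigma| &
      `|sigma| * lam <= 2 * `|h I - h Is|].
Proof.
move=> lam0 Hlam Isint; have [r1 r10 H1] := segment_int_nbhs Isint.
case: (Isint) => SIs _; have IsL := S_line SIs.
have [_ _ _ taylor] := hC2.
have Q0 : 0 <= Q by rewrite addr_ge0.
have k0Q : `|k0| <= Q by rewrite lerDl.
have k1Q : `|k1| <= Q by rewrite lerDr.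
pose Z := 1 + Q * Q / kappa.
have Z0 : 0 < Z by rewrite ltr_wpDr // divr_ge0 ?(ltW kappa0) // mulr_ge0.
pose Y := 2 * (N * Q ^+ 2) * (Q / kappa) + 1.
have Y0 : 0 < Y.
  rewrite ltr_wpDl // mulr_ge0 ?divr_ge0 ?(ltW kappa0) //.
  by rewrite !mulr_ge0 ?sqr_ge0 // ltW.
(* The first bound keeps the projection [y] in the segment, the second makes the quadratic remainder
   at most half of [|sigma| * lam]. *)
exists (Num.min (r1 / Z) (lam / Y)); first by rewrite lt_min !divr_gt0.
move=> I BI; rewrite le_min => /andP[Ir1 Ir2] sigma.
have sE : sigma = (k0 * (I 0 0 - Is 0 0) + k1 * (I 0 1 - Is 0 1)) / kappa.
  by rewrite /sigma; congr (_ / _); lra.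
have sle : `|sigma| <= Q / kappa * `|I - Is|.
  rewrite sE normrM normfV (gtr0_norm kappa0) mulrAC ler_pM2r ?invr_gt0 //.
  apply: le_trans (ler_normD _ _) _; rewrite !normrM /Q mulrDl.
  by rewrite lerD // ler_wpM2l // rV_coordB_le.
pose y : 'rV[R]_2 := I - sigma *: (\row_i (if i == 0 then k0 else k1)).
have y0 : y 0 0 = I 0 0 - sigma * k0 by rewrite !mxE.
have y1 : y 0 1 = I 0 1 - sigma * k1 by rewrite !mxE.
have Iy : `|I - y| <= Q * `|sigma|.
  apply: rV2_norm_le; rewrite !mxE /=.
    have -> : I 0 0 - (I 0 0 - sigma * k0) = sigma * k0 by ring.
    by rewrite normrM mulrC ler_wpM2r.
  have -> : I 0 1 - (I 0 1 - sigma * k1) = sigma * k1 by ring.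
  by rewrite normrM mulrC ler_wpM2r.
have yL : k0 * y 0 0 + k1 * y 0 1 + a = 0.
  have : sigma * kappa = k0 * I 0 0 + k1 * I 0 1 + a.
    by rewrite /sigma divfK // gt_eqF.
  by rewrite y0 y1 /kappa; lra.
have Sy : S y.
  apply: H1 => //; have -> : y - Is = (I - Is) - (I - y).
    by rewrite opprB [in RHS]addrC addrA subrK.
  apply: le_trans (ler_normB _ _) _.
  move: Ir1; rewrite ler_pdivlMr // => Ir1; apply: le_trans Ir1.
  have := ler_wpM2l Q0 sle; have -> : Q * (Q / kappa * `|I - Is|) = `|I - Is| * (Q * Q / kappa) by ring.
  by rewrite /Z; lra.
exists y; split => //.
have := taylor y I (S_box Sy) BI; rewrite sum_ord2 (h_cst Sy SIs).
rewrite y0 y1.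
have -> : hd 0 y * (I 0 0 - (I 0 0 - sigma * k0)) +
   hd 1 y * (I 0 1 - (I 0 1 - sigma * k1)) = sigma * (k0 * hd 0 y + k1 * hd 1 y).
  by ring.
set m := sigma * _ => ht.
have m1 : `|sigma| * lam <= `|m|.
  have -> : `|m| = `|sigma| * `|k0 * hd 0 y + k1 * hd 1 y| by exact: normrM.
  by rewrite ler_wpM2l // Hlam.
have hq : N * `|I - y| ^+ 2 <= `|sigma| * lam / 2.
  have : N * `|I - y| ^+ 2 <= N * (Q * `|sigma|) ^+ 2.
    rewrite ler_wpM2l ?(ltW N0) // ler_sqr ?nnegrE ?mulr_ge0 //.
  move/le_trans; apply.
  have -> : N * (Q * `|sigma|) ^+ 2 = `|sigma| * (N * Q ^+ 2 * `|sigma|) by ring.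
  rewrite -[leRHS]mulrA ler_wpM2l //.
  have NQ : 0 <= N * Q ^+ 2 by rewrite mulr_ge0 ?sqr_ge0 // ltW.
  have := ler_wpM2l NQ sle; move: Ir2; rewrite ler_pdivlMr // /Y.
  have := normr_ge0 (I - Is).
  set A := N * Q ^+ 2; set X := `|I - Is|; set qk := Q / kappa.
  have -> : X * (2 * A * qk + 1) = 2 * (A * (qk * X)) + X by ring.
  by lra.
have := ler_normB (h I - h Is) (h I - h Is - m).
by rewrite (_ : _ - (_ - m) = m); [lra|ring].
Qed.

(** The [j]-th coordinate is affine along the segment and attains an extreme value allowed by the
    box at an interior parameter, so it is constant. *)
Lemma face_direction Is j : segment_int p q Is -> `|Is 0 j| = rho -> u 0 j = 0.
Proof.
move=> [[t /= t01 IsE] nend]; rewrite in_itv /= in t01.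
have {IsE}IsE : Is = point t by rewrite -IsE.
have t0 : t != 0.
  apply/eqP => t0; apply: nend; left.
  by rewrite IsE; apply/rowP => i; rewrite pointE t0; ring.
have t1 : t != 1.
  apply/eqP => t1; apply: nend; right.
  by rewrite IsE; apply/rowP => i; rewrite pointE t1 !mxE; ring.
have Bp := proj1 (action_boxP _ _) (S_box (@segment_point 0 ltac:(lra))) j.
have Bq := proj1 (action_boxP _ _) (S_box (@segment_point 1 ltac:(lra))) j.
rewrite IsE pointE; move: Bp Bq; rewrite !pointE.
set P := p 0 j; set U := u 0 j => Bp Bq E.
have {t0 t1}[t0 t1] : 0 < t /\ t < 1.
  by split; rewrite lt_neqAle; case/andP: t01; [rewrite eq_sym t0|rewrite t1].
have EE : P + t * U = rho \/ P + t * U = - rho.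
  by have [a0|a0] := leP 0 (P + t * U);
   [left; rewrite -E ger0_norm|right; rewrite -E ltr0_norm // opprK].
case: (ltgtP U 0) => // U0.
  have h1 : t * U < 0 by rewrite pmulr_rlt0.
  have h2 : (1 - t) * U < 0 by rewrite pmulr_rlt0 // subr_gt0.
  by case: EE; lra.
have h1 : 0 < t * U by rewrite mulr_gt0.
have h2 : 0 < (1 - t) * U by rewrite mulr_gt0 // subr_gt0.
by case: EE; lra.
Qed.

(** The segment lies in the face, so [k] has a single nonzero component [kj], the [j]-th. A point
    [I] of the face has [sigma = 0], hence [h I = h Is], whereas the shifted point has
    [|sigma| = m * rho / |kj|], hence an energy gap proportional to [m]. *)
Lemma face_barrier (lam r : R) Is I j (m : R) : 0 < lam -> segment_int p q Is ->
  (forall I : 'rV[R]_2, B I -> `|I - Is| <= r ->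
    let sigma := (k0 * I 0 0 + k1 * I 0 1 + a) / kappa in
    exists y, [/\ S y, `|I - y| <= Q * `|sigma| &
      `|sigma| * lam <= 2 * `|h I - h Is|]) ->
  0 <= m -> `|Is 0 j| = rho -> B I -> `|I - Is| <= r -> I 0 j = Is 0 j ->
  B ((1 - m) *: Is) -> `|(1 - m) *: Is - Is| <= r ->
  m * rho * lam <= 2 * Q * `|h ((1 - m) *: Is) - h I|.
Proof.
move=> lam0 Isint Hr m0 Isj BI Ir Ij; set J := (1 - m) *: Is => BJ Jr.
have uj := face_direction Isint Isj; have uk := dir_line; have u0 := dir_neq0.
case: (Isint) => SIs _; have IsL := S_line SIs.
have [kj [kjn kE LE]] : exists kj : R, [/\ kj != 0, kappa = kj ^+ 2 & `|kj| <= Q /\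
    forall I' : 'rV[R]_2, k0 * I' 0 0 + k1 * I' 0 1 + a = kj * I' 0 j + a].
  have kn : kappa != 0 by rewrite gt_eqF.
  case: (ord2P j) uj => -> uj; rewrite uj in uk u0.
    have k10 : k1 = 0.
      apply/eqP; move/eqP: uk; rewrite mulr0 add0r mulf_eq0 => /orP[//|/eqP u1].
      by move: u0; rewrite u1 !expr0n /= addr0 ltxx.
    exists k0; rewrite /Q /kappa k10 normr0 addr0 expr0n /= addr0.
    split=> //; first by apply: contra kn => /eqP e; rewrite /kappa e k10 !expr0n /= addr0.
    by split=> // I'; rewrite mul0r addr0.
  have k00 : k0 = 0.
    apply/eqP; move/eqP: uk; rewrite mulr0 addr0 mulf_eq0 => /orP[//|/eqP u1].
    by move: u0; rewrite u1 !expr0n /= addr0 ltxx.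
  exists k1; rewrite /Q /kappa k00 normr0 add0r expr0n /= add0r.
  split=> //; first by apply: contra kn => /eqP e; rewrite /kappa e k00 !expr0n /= addr0.
  by split=> // I'; rewrite mul0r add0r.
case: LE => kjQ LE; rewrite LE in IsL.
have hI : h I = h Is.
  have [y [Sy Iy _]] := Hr I BI Ir; move: Iy; rewrite LE Ij IsL mul0r normr0 mulr0.
  by rewrite normr_le0 subr_eq0 => /eqP ->; exact: h_cst.
have [_ [_ _]] := Hr J BJ Jr; rewrite LE hI.
have -> : (kj * J 0 j + a) / kappa = - (m * (Is 0 j / kj)).
  have -> : a = - (kj * Is 0 j) by move: IsL; lra.
  rewrite kE /J mxE; field; exact: kjn.
rewrite normrN !normrM normfV Isj (ger0_norm m0) => H.
have kp : 0 < `|kj| by rewrite normr_gt0.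
have -> : m * rho * lam = m * (rho / `|kj|) * lam * `|kj| by field; rewrite gt_eqF.
have := ler_wpM2r (ltW kp) H; set X := `|h J - h Is| => h1.
have h2 : X * `|kj| <= X * Q by rewrite ler_wpM2l ?normr_ge0.
lra.
Qed.

End resonant_segment.

(** * Resonant averages *)

Lemma rV_addZ {R : realType} {n} (x w : 'rV[R]_n) (t : R) i :
  (x + t *: w) 0 i = x 0 i + t * w 0 i.
Proof. by rewrite !mxE. Qed.

Lemma constant_of_quadratic {R : realType} (u : R -> R) (K : R) :
  (forall s t, `|u t - u s| <= K * (t - s) ^+ 2) -> forall s t, u s = u t.
Proof.
move=> H.
suff Hle s t : s <= t -> u s = u t.
  by move=> s t; have [/Hle|/ltW/Hle] := leP s t.
move=> st; have := @slope_bound R (fun r => u (s + r)) (fun=> 0) 0 K (t - s) _ _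
  0 (t - s).
rewrite addr0 mul0r (addrC s) subrK => h; apply/esym/eqP.
rewrite -subr_eq0 -normr_le0; apply: h => //.
- move=> r q _ _ _; rewrite mulr0 subr0.
  by have -> : q - r = s + q - (s + r) by ring.
- by move=> *; rewrite normr0.
- by rewrite subr_ge0.
Qed.

(** Bridge from expansions to the derivatives of the statement: the quotient is within [K * |s|] of
    [d]. Only admissible increments are tested, so one-sided derivatives are covered. *)
Lemma quadratic_is_derive_in {R : realType} {V W : normedModType R} (D : set V)
    (F : V -> W) (x v : V) (d : W) (K : R) :
  (forall s, D (x + s *: v) -> `|F (x + s *: v) - F x - s *: d| <= K * s ^+ 2) ->
  is_derive_in D F x v d.
Proof.
move=> H; apply/cvgrPdist_le => /= e e0.
have hK : 0 < e / (`|K| + 1) by rewrite divr_gt0 // ltr_wpDl.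
suff : \forall s \near (0 : R)^', D (x + s *: v) ->
    `|d - s^-1 *: (F (x + s *: v) - F x)| <= e by [].
near=> s => Ds.
have s0 : s != 0 by near: s; exact: nbhs_dnbhs_neq.
have sK : `|s| <= e / (`|K| + 1) by near: s; exact: dnbhs0_le.
have -> : d - s^-1 *: (F (x + s *: v) - F x) =
    - s^-1 *: (F (x + s *: v) - F x - s *: d).
  by rewrite [RHS]scalerBr !scaleNr scalerA mulVf // scale1r opprK addrC.
rewrite normrZ normrN normfV ler_pdivrMl ?normr_gt0 //.
apply: le_trans (H _ Ds) _.
rewrite -real_normK ?num_real // expr2 mulrCA ler_wpM2l //.
move: sK; rewrite ler_pdivlMr ?ltr_wpDl // => sK; apply: le_trans sK.
by rewrite mulrC ler_wpM2l //; apply: le_trans (ler_norm _) _; rewrite lerDl.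
Unshelve. all: by end_near. Qed.

Lemma periodic_int {R : realType} (V : R -> R) : (forall x, V (x + 1) = V x) ->
  forall (z : int) x, V (x + z%:~R) = V x.
Proof.
move=> H; have Hn (n : nat) x : V (x + n%:R) = V x.
  elim: n x => [|n IH] x; first by rewrite addr0.
  by rewrite -natr1 addrA H IH.
case=> n x; first exact: Hn.
by rewrite NegzE mulrNz -[in RHS](subrK n.+1%:R x) Hn.
Qed.

Section periodic_primitive.
Context {R : realType}.
Implicit Types (g F : R -> R).

(** The increment [G (t + 1) - G t] has zero slope, so it always equals the mean [m] and
    [G t - m * t] is periodic; on [[0, 1]] each of its two terms is at most [N]. *)
Lemma primitive_deviation g (K N : R) : 0 <= K ->
  (forall s t, `|g t - g s| <= K * `|t - s|) -> (forall t, `|g t| <= N) ->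
  (forall t, g (t + 1) = g t) ->
  forall t, `|primitive g t - primitive g 1 * t| <= 2 * N.
Proof.
move=> K0 g_lip gN gper t; set m := primitive g 1.
pose G := primitive g; pose V t := G t - m * t.
have Vper x : V (x + 1) = V x.
  suff : G (x + 1) - G x = m by rewrite /V; lra.
  pose u t := G (t + 1) - G t.
  have -> : m = u 0 by rewrite /u add0r /G primitive0 subr0.
  apply: (@constant_of_quadratic R u (4 * K)) => s r.
  have h1 := primitive_quadratic K0 g_lip (s + 1) (r + 1).
  have h2 := primitive_quadratic K0 g_lip s r.
  rewrite gper in h1.
  have rs : r + 1 - (s + 1) = r - s by ring.
  rewrite rs in h1.
  have -> : u r - u s = (G (r + 1) - G (s + 1) - (r - s) * g s) -
     (G r - G s - (r - s) * g s) by rewrite /u; ring.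
  apply: le_trans (ler_normB _ _) _; rewrite -/G in h1 h2; lra.
rewrite -/G -/(V t) -(periodic_int Vper (- Num.floor t) t).
have := floor_le t; have := floorD1_gt t; rewrite rmorphD /= rmorphN /=.
set x := t - _ => h1 h2; have x0 : 0 <= x by rewrite /x; lra.
have x1 : x <= 1 by rewrite /x; lra.
have hG := primitive_lipschitz K0 g_lip gN 0 x.
have hm := primitive_lipschitz K0 g_lip gN 0 1.
rewrite (primitive0 g) !subr0 in hG hm; rewrite (ger0_norm x0) -/(G x) in hG.
rewrite normr1 mulr1 -/m in hm.
rewrite /V; apply: le_trans (ler_normB _ _) _; rewrite normrM (ger0_norm x0).
have h3 : N * x <= N * 1 by rewrite ler_wpM2l // (le_trans (normr_ge0 _) hm).
have h4 : `|m| * x <= `|m| * 1 by rewrite ler_wpM2l.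
by lra.
Qed.

Lemma primitive_orthogonal F (g0 g1 : R -> R) (C K k0 k1 : R) : 0 <= K ->
  (forall s t, `|g0 t - g0 s| <= K * `|t - s|) ->
  (forall s t, `|g1 t - g1 s| <= K * `|t - s|) ->
  (forall s t, `|F t - F s - (t - s) * (k0 * g0 s + k1 * g1 s)|
    <= C * (t - s) ^+ 2) ->
  F 1 = F 0 ->
  k0 * primitive g0 1 + k1 * primitive g1 1 = 0.
Proof.
move=> K0 lip0 lip1 FE F10.
pose u t := F t - (k0 * primitive g0 t + k1 * primitive g1 t).
have : u 0 = u 1.
  apply: (@constant_of_quadratic R u (C + (`|k0| + `|k1|) * (2 * K))) => s t.
  have h0 := primitive_quadratic K0 lip0 s t.
  have h1 := primitive_quadratic K0 lip1 s t.
  have hq := FE s t.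
  set q := F t - _ - _ in hq; set q0 := primitive g0 t - _ - _ in h0.
  set q1 := primitive g1 t - _ - _ in h1.
  have -> : u t - u s = q - k0 * q0 - k1 * q1 by rewrite /u /q /q0 /q1; ring.
  apply: le_trans (ler_normB _ _) _; have h4 := ler_normB q (k0 * q0).
  have h5 := ler_wpM2l (normr_ge0 k0) h0; have h6 := ler_wpM2l (normr_ge0 k1) h1.
  rewrite -(normrM k0 q0) in h5; rewrite -(normrM k1 q1) in h6.
  have -> : (C + (`|k0| + `|k1|) * (2 * K)) * (t - s) ^+ 2
    = C * (t - s) ^+ 2 + `|k0| * (2 * K * (t - s) ^+ 2)
     + `|k1| * (2 * K * (t - s) ^+ 2) by ring.
  by lra.
rewrite /u (primitive0 g0) (primitive0 g1) F10 !mulr0.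
move: (k0 * primitive g0 1) (k1 * primitive g1 1) => X Y; lra.
Qed.

(** The corrector is a primitive of [k0 * g1 - k1 * g0] minus its mean; subtracting the mean is what
    keeps it bounded for all times. *)
Lemma periodic_corrector (g0 g1 : R -> R) (K N k0 k1 : R) : 0 <= K ->
  (forall s t, `|g0 t - g0 s| <= K * `|t - s|) ->
  (forall s t, `|g1 t - g1 s| <= K * `|t - s|) ->
  (forall t, `|g0 t| <= N) -> (forall t, `|g1 t| <= N) ->
  (forall t, g0 (t + 1) = g0 t) -> (forall t, g1 (t + 1) = g1 t) ->
  exists (V : R -> R) (b K' : R), (forall t, `|V t| <= b) /\
   forall s t, `|V t - V s - (t - s) * (k0 * g1 s - k1 * g0 s
      - (k0 * primitive g1 1 - k1 * primitive g0 1))| <= K' * (t - s) ^+ 2.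
Proof.
move=> K0 lip0 lip1 b0 b1 per0 per1.
exists (fun t => k0 * (primitive g1 t - primitive g1 1 * t)
  - k1 * (primitive g0 t - primitive g0 1 * t)).
exists ((`|k0| + `|k1|) * (2 * N)), ((`|k0| + `|k1|) * (2 * K)); split => [t|s t].
  apply: le_trans (ler_normB _ _) _; rewrite !normrM [leRHS]mulrDl.
  rewrite lerD // ler_wpM2l //.
    exact: primitive_deviation lip1 b1 per1 t.
  exact: primitive_deviation lip0 b0 per0 t.
have h0 := primitive_quadratic K0 lip0 s t.
have h1 := primitive_quadratic K0 lip1 s t.
set q0 := primitive g0 t - _ - _ in h0; set q1 := primitive g1 t - _ - _ in h1.
rewrite (_ : _ - _ - _ = k0 * q1 - k1 * q0); last by rewrite /q0 /q1; ring.
apply: le_trans (ler_normB _ _) _; rewrite !normrM.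
have -> : (`|k0| + `|k1|) * (2 * K) * (t - s) ^+ 2
  = `|k0| * (2 * K * (t - s) ^+ 2) + `|k1| * (2 * K * (t - s) ^+ 2) by ring.
by rewrite lerD // ler_wpM2l.
Qed.

End periodic_primitive.

Section averaging.
Context {R : realType} (rho : R) (f : 'rV[R]_(2 + 2) -> R) (N : R).
Variables (k : 'rV[int]_2) (Is thetas : 'rV[R]_2).
Local Notation P := (phase_space rho).
Local Notation fd := (fun i => partial_in P i f).
Hypothesis N0 : 0 < N.
Hypothesis pf : torus_periodic rho f.
Hypothesis fC2 : C2_bounds P f fd N.
Hypothesis BIs : action_box rho Is.
Let kr : 'rV[R]_2 := map_mx intr k.
Let path (theta : 'rV[R]_2) (t : R) : 'rV[R]_(2 + 2) := row_mx (theta + t *: kr) Is.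
Let g (i : 'I_2) (t : R) : R := partial_in P (lshift 2 i) f (path thetas t).
Let m (i : 'I_2) : R := primitive (g i) 1.

Lemma phase_path theta t : P (path theta t).
Proof. by rewrite /phase_space /= row_mxKr. Qed.

Lemma pathB_l theta s t i :
  path theta t 0 (lshift 2 i) - path theta s 0 (lshift 2 i) = (t - s) * kr 0 i.
Proof. by rewrite !row_mxEl !rV_addZ; ring. Qed.

Lemma path_r theta t i : path theta t 0 (rshift 2 i) = Is 0 i.
Proof. by rewrite row_mxEr. Qed.

Lemma path_lipschitz theta s t : `|path theta t - path theta s| <= `|kr| * `|t - s|.
Proof.
apply: rV_norm_leP => [|j]; first by rewrite mulr_ge0.
rewrite [X in `|X|]mxE [X in _ + X]mxE -(splitK j); case: (fintype.split j) => i /=.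
  by rewrite pathB_l normrM mulrC ler_wpM2r // rV_coord_le.
by rewrite !path_r subrr normr0 mulr_ge0.
Qed.

Let K : R := N * `|kr|.
Let K0 : 0 <= K. Proof. by rewrite mulr_ge0 // ltW. Qed.

Lemma g_lipschitz i s t : `|g i t - g i s| <= K * `|t - s|.
Proof.
have [_ _ lip _] := fC2.
apply: le_trans (lip (lshift 2 i) _ _ (phase_path _ _) (phase_path _ _)) _.
by rewrite -mulrA ler_wpM2l ?(ltW N0) // path_lipschitz.
Qed.

Lemma f_path_lipschitz theta s t :
  `|f (path theta t) - f (path theta s)| <= K * `|t - s|.
Proof.
have [lip _ _ _] := fC2; apply: le_trans (lip _ _ (phase_path _ _) (phase_path _ _)) _.
by rewrite -mulrA ler_wpM2l ?(ltW N0) // path_lipschitz.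
Qed.

Lemma resonant_averageE theta :
  resonant_average f k Is theta = primitive (fun t => f (path theta t)) 1.
Proof.
have cf := lipschitz_continuous (f_path_lipschitz theta).
by have := primitiveB cf (@ler01 R); rewrite primitive0 subr0 => ->.
Qed.

(** Differentiation under the integral sign by [slope_bound]: as a function of the upper limit of
    integration, the left-hand side has slope [e], the pointwise Taylor remainder of [f], which is
    at most [N * s ^+ 2]. *)
Lemma resonant_average_taylor i (s : R) :
  `|resonant_average f k Is (thetas + s *: delta_mx 0 i)
    - resonant_average f k Is thetas - s * m i| <= N * s ^+ 2.
Proof.
have [_ _ _ taylor] := fC2.
set th := thetas + _; rewrite !resonant_averageE /m.
pose u t := primitive (fun t => f (path th t)) t
  - primitive (fun t => f (path thetas t)) t - s * primitive (g i) t.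
pose e t := f (path th t) - f (path thetas t) - s * g i t.
have := @slope_bound R u e (N * s ^+ 2)
  (2 * K + 2 * K + `|s| * (2 * K)) 1 _ _ 0 1 (lexx _) ler01 (lexx _).
rewrite /u !primitive0 mulr0 !subr0 mulr1; apply.
- move=> a b _ _ _.
  have h1 := primitive_quadratic K0 (f_path_lipschitz th) a b.
  have h2 := primitive_quadratic K0 (f_path_lipschitz thetas) a b.
  have h3 := primitive_quadratic K0 (g_lipschitz i) a b.
  move: h1 h2 h3; rewrite /e.
  set p1 := primitive _ b; set p1' := primitive _ a.
  set p2 := primitive _ b; set p2' := primitive _ a.
  set p3 := primitive _ b; set p3' := primitive _ a.
  move=> h1 h2 h3; set q1 := p1 - p1' - _ in h1; set q2 := p2 - p2' - _ in h2.
  set q3 := p3 - p3' - _ in h3.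
  rewrite (_ : _ - _ - _ = q1 - q2 - s * q3); last by rewrite /q1 /q2 /q3; ring.
  apply: le_trans (ler_normB _ _) _; have h4 := ler_normB q1 q2.
  have h5 : `|s * q3| <= `|s| * (2 * K * (b - a) ^+ 2).
    by rewrite normrM ler_wpM2l.
  have -> : (2 * K + 2 * K + `|s| * (2 * K)) * (b - a) ^+ 2 =
    2 * K * (b - a) ^+ 2 + 2 * K * (b - a) ^+ 2 + `|s| * (2 * K * (b - a) ^+ 2).
    by ring.
  by lra.
move=> t _ _; rewrite /e.
have E : path th t = path thetas t + s *: delta_mx 0 (lshift 2 i).
  apply/rowP => j; rewrite axis_coord -(splitK j); case: (fintype.split j) => l /=.
    rewrite !row_mxEl (rV_addZ th) (rV_addZ thetas kr) /th axis_coord eq_lshift.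
    by case: eqP => _; ring.
  by rewrite !row_mxEr eq_rlshift addr0.
have := taylor (path thetas t) (path th t) (phase_path _ _) (phase_path _ _).
rewrite (bigD1 (lshift 2 i)) //= big1; last first.
  by move=> j /negbTE ji; rewrite E axis_coord ji addr0 subrr mulr0.
rewrite addr0.
have -> : path th t 0 (lshift 2 i) - path thetas t 0 (lshift 2 i) = s.
  by rewrite E axis_coord eqxx; ring.
rewrite mulrC; move/le_trans; apply; rewrite ler_wpM2l ?(ltW N0) //.
rewrite E addrC addKr -[s ^+ 2]real_normK ?num_real // ler_sqr ?nnegrE //.
apply: rV_norm_leP => // j; rewrite -[_ *: _]add0r axis_coord mxE add0r.
by case: ifP => // _; rewrite normr0.
Qed.

Lemma gradient_average i :
  gradient_in setT (resonant_average f k Is) thetas 0 i = m i.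
Proof.
have H : is_derive_in setT (resonant_average f k Is : _ -> R^o) thetas
    (delta_mx 0 i) (m i : R^o).
  by apply: (quadratic_is_derive_in (K := N)) => s _; exact: resonant_average_taylor.
have E : within [set s : R | setT (thetas + s *: delta_mx 0 i : 'rV[R]_2)]
    (0 : R)^' = (0 : R)^'.
  by apply/funext => U; congr ((0 : R)^' _); apply/funext => s;
    apply/propext; split=> // /(_ I).
rewrite mxE /partial_in /derive_in /dquot_in; move: H.
by rewrite /is_derive_in /dquot_in E => H; exact: cvg_lim H.
Qed.

(** As [k] is integral, the path closes up on the torus and [f] takes the same value at both ends,
    so its derivative along [k] has mean zero. *)
Lemma average_orthogonal : kr 0 0 * m 0 + kr 0 1 * m 1 = 0.
Proof.
have [_ _ _ taylor] := fC2.
apply: (@primitive_orthogonal R (fun t => f (path thetas t)) (g 0) (g 1)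
  (N * `|kr| ^+ 2) K) => //; try exact: g_lipschitz; last first.
  by rewrite /path scale1r scale0r addr0 pf.
move=> s t; have := taylor _ _ (phase_path thetas s) (phase_path thetas t).
rewrite big_split_ord /= [X in _ - (_ + X)]big1 ?addr0; last first.
  by move=> i _; rewrite !path_r subrr mulr0.
rewrite sum_ord2 !pathB_l -/(g 0 s) -/(g 1 s).
move: (g 0 s) (g 1 s) => g0s g1s.
have -> : g0s * ((t - s) * kr 0 0) + g1s * ((t - s) * kr 0 1) =
  (t - s) * (kr 0 0 * g0s + kr 0 1 * g1s) by ring.
move/le_trans; apply.
rewrite -mulrA ler_wpM2l ?(ltW N0) // -[(t - s) ^+ 2]real_normK ?num_real //.
by rewrite -exprMn ler_sqr ?nnegrE ?mulr_ge0 // path_lipschitz.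
Qed.

(** Here [mu] is the product of the averaged gradient with [(- k1, k0)]. The product with [k] is
    zero by [average_orthogonal], so [mu = 0] would make the whole gradient vanish. *)
Lemma resonant_drift : 0 < kr 0 0 ^+ 2 + kr 0 1 ^+ 2 ->
  gradient_in setT (resonant_average f k Is) thetas <> 0 ->
  exists (mu : R) (V : R -> R) (b K' : R),
  [/\ mu != 0, forall t, `|V t| <= b &
   forall s t, `|V t - V s - (t - s) *
     (kr 0 0 * partial_in P (lshift 2 1) f (path thetas s)
      - kr 0 1 * partial_in P (lshift 2 0) f (path thetas s) - mu)|
     <= K' * (t - s) ^+ 2].
Proof.
move=> kappa0 nz; have [_ bd _ _] := fC2.
have gper i s : g i (s + 1) = g i s.
  rewrite /g /path scalerDl scale1r addrA.
  by rewrite (torus_periodic_partial (lshift 2 i) pf).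
have gN i s : `|g i s| <= N by apply: bd; exact: phase_path.
have [V [b [K' [Vb VE]]]] := periodic_corrector (kr 0 0) (kr 0 1) K0
  (g_lipschitz 0) (g_lipschitz 1) (gN 0) (gN 1) (gper 0) (gper 1).
exists (kr 0 0 * m 1 - kr 0 1 * m 0), V, b, K'; split => //.
apply/eqP => e0; apply: nz; have e1 := average_orthogonal.
have kk (w : R) : (kr 0 0 ^+ 2 + kr 0 1 ^+ 2) * w = 0 -> w = 0.
  by move=> /eqP; rewrite mulf_eq0 (gt_eqF kappa0) => /eqP.
apply: rV2P; rewrite gradient_average [RHS]mxE; apply: kk; move: e0 e1.
  move: (kr 0 0) (kr 0 1) (m 0) (m 1) => a0 a1 m0 m1 e0 e1.
  have -> : (a0 ^+ 2 + a1 ^+ 2) * m0 = a0 * (a0 * m0 + a1 * m1)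
    - a1 * (a0 * m1 - a1 * m0) by ring.
  by rewrite e0 e1; ring.
move: (kr 0 0) (kr 0 1) (m 0) (m 1) => a0 a1 m0 m1 e0 e1.
have -> : (a0 ^+ 2 + a1 ^+ 2) * m1 = a1 * (a0 * m0 + a1 * m1)
  + a0 * (a0 * m1 - a1 * m0) by ring.
by rewrite e0 e1; ring.
Qed.

End averaging.

(** * Energy and confinement *)

Section expansions.
Context {R : realType} (T : R).
Implicit Types (u e : R -> R) (a b : R).

(** A uniform form of [u' = e] on [[0, T]], expanded at the left end of each interval. The constant
    is hidden because only its existence matters to [bisection_bound]. *)
Definition expands u e := exists K, forall s t, 0 <= s -> s <= t -> t <= T ->
  `|u t - u s - (t - s) * e s| <= K * (t - s) ^+ 2.

Lemma expands_lin u1 u2 e1 e2 a b : expands u1 e1 -> expands u2 e2 ->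
  expands (fun t => a * u1 t + b * u2 t) (fun s => a * e1 s + b * e2 s).
Proof.
move=> [K1 H1] [K2 H2]; exists (`|a| * K1 + `|b| * K2) => s t s0 st tT.
rewrite (_ : _ - _ - _ = a * (u1 t - u1 s - (t - s) * e1 s)
  + b * (u2 t - u2 s - (t - s) * e2 s)); last by ring.
apply: le_trans (ler_normD _ _) _; rewrite !normrM.
have -> : (`|a| * K1 + `|b| * K2) * (t - s) ^+ 2 =
  `|a| * (K1 * (t - s) ^+ 2) + `|b| * (K2 * (t - s) ^+ 2) by ring.
by rewrite lerD // ler_wpM2l // ?H1 ?H2.
Qed.

Lemma expands_affine a b : expands (fun t => a * t + b) (fun=> a).
Proof.
exists 0 => s t _ _ _; rewrite (_ : _ - _ - _ = 0); last by ring.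
by rewrite normr0 mul0r.
Qed.

Lemma eq_expands u u' e e' : (forall t, u t = u' t) ->
  (forall t, 0 <= t -> t <= T -> e t = e' t) -> expands u e -> expands u' e'.
Proof.
move=> eu ee [K H]; exists K => s t s0 st tT.
by rewrite -!eu -ee ?H //; exact: le_trans tT.
Qed.

Lemma expands_bound u e A : expands u e ->
  (forall s, 0 <= s -> s <= T -> `|e s| <= A) ->
  forall s t, 0 <= s -> s <= t -> t <= T -> `|u t - u s| <= A * (t - s).
Proof. by move=> [K H]; exact: slope_bound H. Qed.

Lemma expands_comp (V v phi w : R -> R) (K A W : R) :
  (forall x y, `|V y - V x - (y - x) * v x| <= K * (y - x) ^+ 2) ->
  (forall x, `|v x| <= A) -> expands phi w ->
  (forall s, 0 <= s -> s <= T -> `|w s| <= W) ->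
  expands (fun t => V (phi t)) (fun s => w s * v (phi s)).
Proof.
move=> HV vA hphi wW; have lip := expands_bound hphi wW.
case: hphi => K2 H2; exists (`|K| * W ^+ 2 + K2 * A) => s t s0 st tT.
have d := lip _ _ s0 st tT.
have h1 := HV (phi s) (phi t); have h2 := H2 _ _ s0 st tT.
have h3 : K * (phi t - phi s) ^+ 2 <= `|K| * W ^+ 2 * (t - s) ^+ 2.
  apply: (@le_trans _ _ (`|K| * (phi t - phi s) ^+ 2)).
    by rewrite ler_wpM2r ?sqr_ge0 // ler_norm.
  rewrite -mulrA ler_wpM2l // -exprMn -real_normK ?num_real //.
  by rewrite ler_sqr ?nnegrE //; exact: le_trans d.
rewrite (_ : _ - _ - _ = (V (phi t) - V (phi s) - (phi t - phi s) * v (phi s))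
  + (phi t - phi s - (t - s) * w s) * v (phi s)); last by ring.
apply: le_trans (ler_normD _ _) _; rewrite [leRHS]mulrDl lerD ?(le_trans h1) //.
by rewrite normrM mulrAC ler_pM.
Qed.

End expansions.

Section flow.
Context {R : realType} (rho : R) (h : 'rV[R]_2 -> R) (hd : 'I_2 -> 'rV[R]_2 -> R).
Variables (f : 'rV[R]_(2 + 2) -> R) (fd : 'I_(2 + 2) -> 'rV[R]_(2 + 2) -> R).
Variables (Nh Nf eps : R).
Hypothesis rho0 : 0 < rho.
Hypothesis Nh0 : 0 < Nh.
Hypothesis Nf0 : 0 < Nf.
Local Notation B := (action_box rho).
Local Notation P := (phase_space rho).
Hypothesis hC2 : C2_bounds B h hd Nh.
Hypothesis fC2 : C2_bounds P f fd Nf.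
Hypothesis eps0 : 0 < eps.
Hypothesis eps1 : eps <= 1.

Definition clamp_phase (x : 'rV[R]_(2 + 2)) : 'rV[R]_(2 + 2) :=
  row_mx (lsubmx x) (\row_i clamp (- rho) rho (rsubmx x 0 i)).

Definition vel_theta (i : 'I_2) (x : 'rV[R]_(2 + 2)) : R :=
  hd i (rsubmx x) + eps * fd (rshift 2 i) x.

Definition vel_I (i : 'I_2) (x : 'rV[R]_(2 + 2)) : R :=
  - (eps * fd (lshift 2 i) x).

(* Clamping the actions makes the field globally Lipschitz, so that trajectories
   exist before they are known to stay in the box. *)
Definition clamped_field (x : 'rV[R]_(2 + 2)) : 'rV[R]_(2 + 2) :=
  row_mx (\row_i vel_theta i (clamp_phase x)) (\row_i vel_I i (clamp_phase x)).

Let M := Nh + Nf.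

Lemma rsubmx_normB (x y : 'rV[R]_(2 + 2)) : `|rsubmx y - rsubmx x| <= `|y - x|.
Proof.
apply: rV_norm_leP => // i; rewrite 2!mxE [X in _ + X]mxE [X in _ - X]mxE.
exact: rV_coordB_le.
Qed.

Lemma clamp_phase_in x : P (clamp_phase x).
Proof.
rewrite /phase_space /= row_mxKr; apply/action_boxP => i.
by rewrite mxE; apply: clamp_itv; have := rho0; lra.
Qed.

Lemma clamp_phase_id x : P x -> clamp_phase x = x.
Proof.
move=> /action_boxP Px; rewrite -[RHS]hsubmxK; congr row_mx.
by apply/rowP => i; rewrite [LHS]mxE clamp_id.
Qed.

Lemma clamp_phase_lipschitz x y : `|clamp_phase y - clamp_phase x| <= `|y - x|.
Proof.
apply: rV_norm_leP => // j; rewrite [X in `|X|]mxE [X in _ + X]mxE.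
rewrite -(splitK j); case: (fintype.split j) => i /=.
  by rewrite !row_mxEl 2!mxE rV_coordB_le.
rewrite !row_mxEr !mxE; apply: le_trans (clamp_lipschitz _ _ _ _) _.
exact: rV_coordB_le.
Qed.

Lemma vel_theta_bound i x : P x -> `|vel_theta i x| <= M.
Proof.
move=> Px; have [_ hb _ _] := hC2; have [_ fb _ _] := fC2.
apply: le_trans (ler_normD _ _) _; rewrite lerD ?hb // normrM (gtr0_norm eps0).
have := fb (rshift 2 i) x Px; have := normr_ge0 (fd (rshift 2 i) x).
by move=> g0 g1; rewrite -[leRHS]mul1r ler_pM // ltW.
Qed.

Lemma vel_I_bound i x : P x -> `|vel_I i x| <= eps * Nf.
Proof.
move=> Px; have [_ fb _ _] := fC2.
by rewrite normrN normrM (gtr0_norm eps0) ler_wpM2l ?(ltW eps0) ?fb.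
Qed.

Let epsNf : eps * Nf <= M.
Proof.
have : eps * Nf <= 1 * Nf by rewrite ler_wpM2r // ltW.
by have := Nh0; rewrite /M; lra.
Qed.

Let M0 : 0 < M. Proof. by rewrite addr_gt0. Qed.

Lemma clamped_field_bound x : `|clamped_field x| <= M.
Proof.
have Px := clamp_phase_in x; apply: rV_norm_leP => [|j]; first exact: ltW.
rewrite -(splitK j); case: (fintype.split j) => i /=.
  by rewrite row_mxEl mxE vel_theta_bound.
by rewrite row_mxEr mxE; apply: le_trans (vel_I_bound _ Px) _.
Qed.

Lemma clamped_field_lipschitz x y : `|clamped_field y - clamped_field x| <= M * `|y - x|.
Proof.
have Px := clamp_phase_in x; have Py := clamp_phase_in y.
have [_ _ hl _] := hC2; have [_ _ fl _] := fC2.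
have cl := clamp_phase_lipschitz x y.
have hf j : `|eps * (fd j (clamp_phase y) - fd j (clamp_phase x))| <= Nf * `|y - x|.
  rewrite normrM (gtr0_norm eps0) -[leRHS]mul1r ler_pM // ?(ltW eps0) //.
  by apply: le_trans (fl _ _ _ Px Py) _; rewrite ler_wpM2l ?(ltW Nf0).
apply: rV_norm_leP => [|j]; first by rewrite mulr_ge0 // ltW.
rewrite [X in `|X|]mxE [X in _ + X]mxE.
rewrite -(splitK j); case: (fintype.split j) => i /=.
  rewrite !row_mxEl !mxE /vel_theta [leRHS]mulrDl.
  set a := hd i _; set b := hd i _; set c := fd _ _; set d := fd _ _.
  rewrite (_ : _ - _ = (a - b) + eps * (c - d)); last by ring.
  apply: le_trans (ler_normD _ _) _; rewrite lerD ?hf //.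
  apply: le_trans (hl i _ _ Px Py) _; rewrite ler_wpM2l ?(ltW Nh0) //.
  exact: le_trans (rsubmx_normB _ _) _.
rewrite !row_mxEr !mxE /vel_I.
set c := fd _ _; set d := fd _ _.
rewrite (_ : _ - _ = - (eps * (c - d))); last by ring.
rewrite normrN [leRHS]mulrDl; apply: le_trans (hf _) _.
by rewrite lerDr mulr_ge0 // ltW.
Qed.

Section trajectory.
Variables (x : R -> 'rV[R]_(2 + 2)) (K T : R).
Hypothesis xE : forall s t, 0 <= s -> 0 <= t ->
  `|x t - x s - (t - s) *: clamped_field (x s)| <= K * (t - s) ^+ 2.

Lemma trajectory_expands S j :
  expands S (fun t => x t 0 j) (fun s => clamped_field (x s) 0 j).
Proof.
exists K => s t s0 st _; apply: le_trans (xE s0 (le_trans s0 st)).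
by apply: le_trans (rV_coord_le _ j); rewrite !mxE.
Qed.

Lemma trajectory_lipschitz s t : 0 <= s -> s <= t -> `|x t - x s| <= M * (t - s).
Proof.
move=> s0 st; apply: rV_norm_leP => [|j].
  by rewrite mulr_ge0 ?subr_ge0 // ltW.
rewrite [X in `|X|]mxE [X in _ + X]mxE.
apply: (expands_bound (@trajectory_expands t j)) => // r _ _.
exact: le_trans (rV_coord_le _ _) (clamped_field_bound _).
Qed.

Lemma action_lipschitz s t : 0 <= s -> s <= t ->
  `|rsubmx (x t) - rsubmx (x s)| <= eps * Nf * (t - s).
Proof.
move=> s0 st; apply: rV_norm_leP => [|i].
  by rewrite mulr_ge0 ?subr_ge0 // mulr_ge0 // ltW.
rewrite 2!mxE [X in _ + X]mxE [X in _ - X]mxE.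
apply: (expands_bound (@trajectory_expands t (rshift 2 i))) => // r _ _.
by rewrite /clamped_field row_mxEr mxE vel_I_bound //; exact: clamp_phase_in.
Qed.

(** The first order terms cancel by the antisymmetry of Hamilton's equations, which leaves a
    function of zero slope. Inside the box the clamp is the identity, so the field is the
    Hamiltonian one there. *)
Lemma energy_conservation S : (forall t, 0 <= t -> t <= S -> P (x t)) ->
  forall t, 0 <= t -> t <= S -> perturbed h eps f (x t) = perturbed h eps f (x 0).
Proof.
move=> inP; have [_ _ _ th] := hC2; have [_ _ _ tf] := fC2.
have H : expands S (fun t => perturbed h eps f (x t)) (fun=> 0).
  exists (Nh * M ^+ 2 + Nf * M ^+ 2 + 4 * (M * K)) => s t s0 st tS.
  rewrite mulr0 subr0.
  have t0 := le_trans s0 st.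
  have Ps := inP s s0 (le_trans st tS); have Pt := inP t t0 tS.
  have lip := trajectory_lipschitz s0 st.
  have lip2 : `|x t - x s| ^+ 2 <= M ^+ 2 * (t - s) ^+ 2.
    by rewrite -exprMn ler_sqr ?nnegrE // mulr_ge0 ?subr_ge0 // ltW.
  have r1 := th _ _ Ps Pt; have r2 := tf _ _ Ps Pt.
  have dev j : `|x t 0 j - x s 0 j - (t - s) * clamped_field (x s) 0 j| <= K * (t - s) ^+ 2.
    by apply: le_trans (xE s0 t0); apply: le_trans (rV_coord_le _ j); rewrite !mxE.
  have devt i := dev (lshift 2 i); have devI i := dev (rshift 2 i).
  rewrite /clamped_field clamp_phase_id // in devt devI.
  have {}devt i : `|x t 0 (lshift 2 i) - x s 0 (lshift 2 i) -
      (t - s) * vel_theta i (x s)| <= K * (t - s) ^+ 2.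
    by have := devt i; rewrite row_mxEl mxE.
  have {}devI i : `|x t 0 (rshift 2 i) - x s 0 (rshift 2 i) -
      (t - s) * vel_I i (x s)| <= K * (t - s) ^+ 2.
    by have := devI i; rewrite row_mxEr mxE.
  have vt i := vel_theta_bound i Ps.
  have vI i := le_trans (vel_I_bound i Ps) epsNf.
  have e1 : Nh * `|rsubmx (x t) - rsubmx (x s)| ^+ 2 <= Nh * M ^+ 2 * (t - s) ^+ 2.
    rewrite -mulrA ler_wpM2l ?(ltW Nh0) //; apply: le_trans lip2.
    by rewrite ler_sqr ?nnegrE // rsubmx_normB.
  have e2 : Nf * `|x t - x s| ^+ 2 <= Nf * M ^+ 2 * (t - s) ^+ 2.
    by rewrite -mulrA ler_wpM2l ?(ltW Nf0).
  move: r1 r2 => /le_trans/(_ e1) r1 /le_trans/(_ e2) r2.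
  rewrite big_split_ord /= !sum_ord2 in r2; rewrite sum_ord2 in r1.
  have rs r i : rsubmx (x r) 0 i = x r 0 (rshift 2 i) by rewrite mxE.
  rewrite !rs in r1; rewrite /perturbed.
  set ht := h _; set hs := h _; set ft := f _; set fs := f _.
  rewrite -/ht -/hs in r1; rewrite -/ft -/fs in r2.
  have pr i : `|vel_theta i (x s) * (x t 0 (rshift 2 i) - x s 0 (rshift 2 i) -
      (t - s) * vel_I i (x s))| <= M * (K * (t - s) ^+ 2).
    by rewrite normrM ler_pM.
  have pl i : `|vel_I i (x s) * (x t 0 (lshift 2 i) - x s 0 (lshift 2 i) -
      (t - s) * vel_theta i (x s))| <= M * (K * (t - s) ^+ 2).
    by rewrite normrM ler_pM.
  have := pr 0; have := pr 1; have := pl 0; have := pl 1; move: r1 r2.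
  rewrite /vel_theta /vel_I.
  set q1 := ht - hs - _; set q2 := ft - fs - _ => r1 r2.
  set l1 := _ * _; set l0 := - _ * _; set m1 := (hd 1 _ + _) * _.
  set m0 := (hd 0 _ + _) * _ => hl1 hl0 hm1 hm0.
  (* [q1] and [q2] are Taylor remainders of [h] and [f]; the other terms pair a velocity with the
     deviation of the orbit from its tangent. The products [vel_theta i * vel_I i] occur with both
     signs and drop out. *)
  rewrite (_ : _ - _ = q1 + eps * q2 + m0 + m1 - l0 - l1); last first.
    by rewrite /q1 /q2 /m0 /m1 /l0 /l1; ring.
  have r2' : `|eps * q2| <= Nf * M ^+ 2 * (t - s) ^+ 2.
    by rewrite normrM (gtr0_norm eps0) -[leRHS]mul1r ler_pM // ltW.
  rewrite !ler_norml in r1 r2' hl1 hl0 hm1 hm0 *.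
  by apply/andP; split; lra.
move=> t t0 tS; apply/eqP; rewrite -subr_eq0 -normr_le0.
have := expands_bound H (A := 0) _ (lexx 0) t0 tS; rewrite mul0r; apply.
by move=> *; rewrite normr0.
Qed.

(** Continuation on the set [A] of times up to which the orbit has stayed in the box. The strict
    bound at time [t] may rely on the whole past, which makes energy conservation available for
    proving it. *)
Lemma trajectory_stays : P (x 0) ->
  (forall t, 0 <= t -> t <= T -> (forall s, 0 <= s -> s <= t -> P (x s)) ->
    forall i, `|rsubmx (x t) 0 i| < rho) ->
  forall t, 0 <= t -> t <= T -> P (x t).
Proof.
move=> P0 Hin.
pose A := [set t | [/\ 0 <= t, t <= T & forall s, 0 <= s -> s <= t -> P (x s)]].
have [T0|T0] := leP 0 T; last by move=> t t0 tT; move: (le_lt_trans t0 (le_lt_trans tT T0)); rewrite ltxx.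
have A0 : A 0.
  by split => // s s0 s1; rewrite (_ : s = 0) //; apply/eqP; rewrite eq_le s0 s1.
have supA : has_sup A by split; [exists 0|exists T => t []].
pose t1 := sup A.
have t10 : 0 <= t1 by apply: ub_le_sup => //; case: supA.
have t1T : t1 <= T by apply: ge_sup; [exists 0|move=> t []].
have below s : 0 <= s -> s < t1 -> P (x s).
  move=> s0 st1; have [t [At st]] : exists t, A t /\ s < t.
    have := sup_adherent (eps := t1 - s) _ supA; rewrite subr_gt0.
    move=> /(_ st1)[t At]; rewrite -/t1 => h1.
    by exists t; split => //; move: h1; rewrite opprB addrC subrK.
  by case: At => _ _; apply => //; exact: ltW.
have coord i s t : 0 <= s -> s <= t ->
    `|rsubmx (x t) 0 i - rsubmx (x s) 0 i| <= M * (t - s).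
  move=> s0 st; apply: le_trans (rV_coordB_le _ _ _) _.
  exact: le_trans (rsubmx_normB _ _) (trajectory_lipschitz s0 st).
(* The supremum is attained: the box is closed and the orbit is Lipschitz along the times
   [t1 - t1 * 2^-m]. *)
have At1 : A t1.
  split => // s s0; rewrite le_eqVlt => /predU1P[->|]; last exact: below.
  move: t10; rewrite le_eqVlt => /predU1P[<- //|t1p].
  apply/action_boxP => i; rewrite -ler_norml.
  apply: (@le_add_geometric _ _ _ (M * t1)) => m.
  have h2 : 0 < (2^-1 : R) ^+ m by rewrite exprn_gt0.
  have h3 : (2^-1 : R) ^+ m <= 1 by apply: exprn_ile1; lra.
  pose r := t1 - t1 * 2^-1 ^+ m.
  have hh : t1 * 2^-1 ^+ m <= t1 * 1 by rewrite ler_wpM2l // ltW.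
  have hp : 0 < t1 * 2^-1 ^+ m by rewrite mulr_gt0.
  have r0 : 0 <= r by rewrite /r; lra.
  have rt : r < t1 by rewrite /r; lra.
  have := proj1 (action_boxP rho _) (below r r0 rt) i; rewrite -ler_norml => hr.
  have := coord i r t1 r0 (ltW rt).
  have -> : M * (t1 - r) = M * t1 * 2^-1 ^+ m by rewrite /r; ring.
  move=> hc; have := ler_normD (rsubmx (x r) 0 i) (rsubmx (x t1) 0 i - rsubmx (x r) 0 i).
  by rewrite addrC subrK; lra.
have t1E : t1 = T.
  apply/eqP; rewrite eq_le t1T leNgt /=; apply/negP => lt1.
  have [_ _ At1'] := At1.
  have int := Hin t1 t10 t1T At1'.
  pose d0 := rho - `|rsubmx (x t1) 0 0|; pose d1 := rho - `|rsubmx (x t1) 0 1|.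
  pose d := Num.min d0 d1.
  have dp : 0 < d by rewrite lt_min !subr_gt0 !int.
  have dd i : `|rsubmx (x t1) 0 i| + d <= rho.
    have : d <= d0 by rewrite ge_min lexx.
    have : d <= d1 by rewrite ge_min lexx orbT.
    by case: (ord2P i) => ->; rewrite /d0 /d1; lra.
  (* At speed at most [M], no action covers the distance [d] left to the faces before the time
     [d / M], so [A] would extend beyond its supremum. *)
  pose t2 := Num.min T (t1 + d / M).
  have t12 : t1 < t2 by rewrite lt_min lt1 ltrDl divr_gt0.
  suff : A t2 by move=> /(ub_le_sup (proj2 supA)); rewrite -/t1 leNgt t12.
  split; [by apply: ltW; exact: le_lt_trans t12|by rewrite ge_min lexx|].
  move=> s s0 st2; have [st1|t1s] := leP s t1; first exact: At1'.
  apply/action_boxP => i; rewrite -ler_norml; apply: le_trans (dd i).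
  have := coord i t1 s t10 (ltW t1s).
  have hs : M * (s - t1) <= d.
    have : s <= t1 + d / M by apply: le_trans st2 _; rewrite ge_min lexx orbT.
    by move=> h1; rewrite mulrC -ler_pdivlMr // lerBlDl.
  move=> hc; have := ler_normD (rsubmx (x t1) 0 i) (rsubmx (x s) 0 i - rsubmx (x t1) 0 i).
  by rewrite addrC subrK; lra.
by move: At1; rewrite t1E => -[].
Qed.

End trajectory.
End flow.

(** * Drift *)

Lemma lin2_bound {R : realType} (a b X Y Z : R) : `|X| <= Z -> `|Y| <= Z ->
  `|a * X + b * Y| <= (`|a| + `|b|) * Z.
Proof.
move=> hX hY; apply: le_trans (ler_normD _ _) _; rewrite !normrM [leRHS]mulrDl.
by rewrite lerD // ler_wpM2l.
Qed.

Lemma expands_shift {R : realType} (T : R) (u e : R -> R) (c : R) :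
  expands T u e -> expands T (fun t => u t - c) e.
Proof.
move=> [K H]; exists K => s t s0 st tT.
by rewrite (_ : u t - c - (u s - c) = u t - u s) ?H //; ring.
Qed.

Section drift.
Context {R : realType} (rho : R) (h : 'rV[R]_2 -> R) (hd : 'I_2 -> 'rV[R]_2 -> R).
Variables (f : 'rV[R]_(2 + 2) -> R) (fd : 'I_(2 + 2) -> 'rV[R]_(2 + 2) -> R).
Variables (Nh Nf eps : R).
Hypothesis rho0 : 0 < rho.
Hypothesis Nh0 : 0 < Nh.
Hypothesis Nf0 : 0 < Nf.
Local Notation B := (action_box rho).
Local Notation P := (phase_space rho).
Hypothesis hC2 : C2_bounds B h hd Nh.
Hypothesis fC2 : C2_bounds P f fd Nf.
Hypothesis eps0 : 0 < eps.
Hypothesis eps1 : eps <= 1.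
Local Notation F := (clamped_field rho hd fd eps).
Local Notation vth := (vel_theta hd fd eps).
Local Notation vI := (vel_I fd eps).
Variables (x : R -> 'rV[R]_(2 + 2)) (K delta c : R).
Hypothesis xE : forall s t, 0 <= s -> 0 <= t ->
  `|x t - x s - (t - s) *: F (x s)| <= K * (t - s) ^+ 2.
Hypothesis delta0 : 0 < delta.
Hypothesis delta1 : delta <= 1.
Hypothesis eps_delta : eps <= delta ^+ 2.
Hypothesis c0 : 0 <= c.
Let T := delta * eps^-1.
Hypothesis inP : forall t, 0 <= t -> t <= T -> P (x t).
Variables (kr Is thetas : 'rV[R]_2).
Local Notation k0 := (kr 0 0).
Local Notation k1 := (kr 0 1).
Let kappa : R := k0 ^+ 2 + k1 ^+ 2.
Let Q : R := `|k0| + `|k1|.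
Let Qk : R := `|k0 / kappa| + `|k1 / kappa|.
Hypothesis kappa0 : 0 < kappa.
Hypothesis BIs : B Is.
Hypothesis theta_start : lsubmx (x 0) = thetas.
Hypothesis I_start : `|rsubmx (x 0) - Is| <= c * eps.
Hypothesis near_resonance : forall t, 0 <= t -> t <= T -> exists y,
  [/\ B y, k0 * hd 1 y - k1 * hd 0 y = 0 & `|rsubmx (x t) - y| <= c * eps].
Let path (t : R) : 'rV[R]_(2 + 2) := row_mx (thetas + t *: kr) Is.
Variables (mu b K' : R) (V : R -> R).
Hypothesis Vb : forall t, `|V t| <= b.
Let v (s : R) : R := k0 * fd (lshift 2 1) (path s) - k1 * fd (lshift 2 0) (path s) - mu.
Hypothesis VE : forall s t, `|V t - V s - (t - s) * v s| <= K' * (t - s) ^+ 2.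
Let lam : R := k0 / kappa * hd 0 Is + k1 / kappa * hd 1 Is.

Let epsT : eps * T = delta.
Proof. by rewrite /T mulrC divfK // gt_eqF. Qed.

Let T0 : 0 <= T. Proof. by rewrite divr_ge0 // ltW. Qed.

Let eps_le : eps <= delta.
Proof.
apply: le_trans eps_delta _; rewrite expr2 -[leRHS]mulr1 ler_wpM2l //.
exact: ltW.
Qed.

Let th_exp i : expands T (fun t => x t 0 (lshift 2 i)) (fun s => vth i (x s)).
Proof.
apply: eq_expands (trajectory_expands xE T (lshift 2 i)) => // t t0 tT.
by rewrite /clamped_field clamp_phase_id ?row_mxEl ?mxE //; exact: inP.
Qed.

Let I_exp i : expands T (fun t => x t 0 (rshift 2 i)) (fun s => vI i (x s)).
Proof.
apply: eq_expands (trajectory_expands xE T (rshift 2 i)) => // t t0 tT.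
by rewrite /clamped_field clamp_phase_id ?row_mxEr ?mxE //; exact: inP.
Qed.

Let I_near t : 0 <= t -> t <= T -> `|rsubmx (x t) - Is| <= (c + Nf) * delta.
Proof.
move=> t0 tT.
have h1 := action_lipschitz rho0 Nf0 fC2 eps0 xE (lexx 0) t0.
have h2 : eps * Nf * (t - 0) <= Nf * delta.
  by rewrite subr0 -epsT mulrAC [leRHS]mulrC ler_wpM2r ?(ltW Nf0) // ler_wpM2l // ltW.
have h3 : c * eps <= c * delta by rewrite ler_wpM2l.
rewrite (_ : _ - Is = (rsubmx (x t) - rsubmx (x 0)) + (rsubmx (x 0) - Is)); last first.
  by rewrite addrA subrK.
apply: le_trans (ler_normD _ _) _.
have := I_start; lra.
Qed.

Let vth_near i s y r : 0 <= s -> s <= T -> B y -> `|rsubmx (x s) - y| <= r ->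
  `|vth i (x s) - hd i y| <= Nh * r + eps * Nf.
Proof.
move=> s0 sT By hr; have [_ _ hl _] := hC2; have [_ fb _ _] := fC2.
have Ps := inP s0 sT.
rewrite /vel_theta (_ : _ - _ = (hd i (rsubmx (x s)) - hd i y)
  + eps * fd (rshift 2 i) (x s)); last by ring.
apply: le_trans (ler_normD _ _) _; apply: lerD.
  by apply: le_trans (hl i _ _ By Ps) _; rewrite ler_wpM2l // ltW.
by rewrite normrM (gtr0_norm eps0) ler_wpM2l ?(ltW eps0) ?fb.
Qed.

(** Angles in a frame adapted to the resonance: [theta - thetas = phi * (k0, k1) + psi * (- k1,
    k0)]. Thus [phi] is the position along the resonant path, [psi] the deviation from it, and [w]
    below the speed of [phi]. *)
Let phi t : R := k0 / kappa * x t 0 (lshift 2 0) + k1 / kappa * x t 0 (lshift 2 1)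
  - (k0 / kappa * thetas 0 0 + k1 / kappa * thetas 0 1).
Let psi t : R := k0 / kappa * x t 0 (lshift 2 1) + - (k1 / kappa) * x t 0 (lshift 2 0)
  - (k0 / kappa * thetas 0 1 + - (k1 / kappa) * thetas 0 0).
Let w s : R := k0 / kappa * vth 0 (x s) + k1 / kappa * vth 1 (x s).

Let x0_l i : x 0 0 (lshift 2 i) = thetas 0 i.
Proof. by rewrite -theta_start mxE. Qed.

Let psi0 : psi 0 = 0.
Proof. by rewrite /psi !x0_l subrr. Qed.

Let Cpsi : R := Qk * (Nh * c + Nf).

(** At the nearby point [y] the gradient of [h] is parallel to [k], so [psi] has speed [O(eps)].
    Comparing with [y], at distance [c * eps], rather than with [Is] is essential over a time
    [delta / eps]. *)
Let psi_bound t : 0 <= t -> t <= T -> `|psi t| <= Cpsi * delta.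
Proof.
move=> t0 tT.
have hexp : expands T psi (fun s => k0 / kappa * vth 1 (x s)
    + - (k1 / kappa) * vth 0 (x s)).
  by apply: expands_shift; exact: expands_lin.
have := expands_bound hexp (A := Cpsi * eps) _ (lexx 0) t0 tT.
rewrite psi0 !subr0 => H; apply: le_trans (H _) _ => [s s0 sT|].
  have [y [By yk hy]] := near_resonance s0 sT.
  have e0 := vth_near 0 s0 sT By hy; have e1 := vth_near 1 s0 sT By hy.
  rewrite (_ : _ + _ = k0 / kappa * (vth 1 (x s) - hd 1 y)
    + - (k1 / kappa) * (vth 0 (x s) - hd 0 y)
    + kappa^-1 * (k0 * hd 1 y - k1 * hd 0 y)); last first.
    by move: (vth 1 _) (vth 0 _) => *; ring.
  rewrite yk mulr0 addr0; apply: le_trans (lin2_bound _ _ e1 e0) _; rewrite normrN -/Qk /Cpsi.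
  by rewrite (_ : Nh * (c * eps) + eps * Nf = (Nh * c + Nf) * eps) ?mulrA //; ring.
rewrite -mulrA ler_wpM2l //.
  rewrite mulr_ge0 ?addr_ge0 // ?mulr_ge0 //; exact: ltW.
by rewrite -epsT ler_wpM2l // ltW.
Qed.

Let Cphi : R := Qk * (Nh * (c + Nf) + Nf).

(** An error [O(delta)] suffices here: [w - lam] only enters a slope that already carries a factor
    [eps]. *)
Let w_near s : 0 <= s -> s <= T -> `|w s - lam| <= Cphi * delta.
Proof.
move=> s0 sT.
have hI := I_near s0 sT.
have e0 := vth_near 0 s0 sT BIs hI; have e1 := vth_near 1 s0 sT BIs hI.
rewrite (_ : _ - _ = k0 / kappa * (vth 0 (x s) - hd 0 Is)
   + k1 / kappa * (vth 1 (x s) - hd 1 Is)); last first.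
  by rewrite /w /lam; move: (vth 1 _) (vth 0 _) => *; ring.
apply: le_trans (lin2_bound _ _ e0 e1) _; rewrite -/Qk /Cphi -mulrA ler_wpM2l ?addr_ge0 //.
have : eps * Nf <= delta * Nf by rewrite ler_wpM2r // ltW.
by lra.
Qed.

Let Cx : R := Q * Cpsi + (c + Nf).

Let path_near s : 0 <= s -> s <= T -> `|x s - path (phi s)| <= Cx * delta.
Proof.
move=> s0 sT; have hI := I_near s0 sT; have hp := psi_bound s0 sT.
have cd0 : 0 <= (c + Nf) * delta by exact: le_trans hI.
have pd0 : 0 <= Q * (Cpsi * delta).
  by rewrite mulr_ge0 ?addr_ge0 // (le_trans _ hp).
have k0Q : `|k0| <= Q by rewrite lerDl.
have k1Q : `|k1| <= Q by rewrite lerDr.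
have CxE : Cx * delta = Q * (Cpsi * delta) + (c + Nf) * delta by rewrite /Cx; ring.
apply: rV_norm_leP => [|j]; first by rewrite CxE addr_ge0.
rewrite [X in `|X|]mxE [X in _ + X]mxE -(splitK j); case: (fintype.split j) => i /=.
  rewrite row_mxEl rV_addZ CxE; apply: (@le_trans _ _ (Q * (Cpsi * delta))); last first.
    by rewrite lerDl.
  have kn : k0 ^+ 2 + k1 ^+ 2 != 0 by rewrite -/kappa gt_eqF.
  case: (ord2P i) => ->.
    rewrite (_ : _ - _ = k1 * - psi s).
      by rewrite normrM normrN ler_pM.
    by rewrite /phi /psi /kappa; field.
  rewrite (_ : _ - _ = k0 * psi s); first by rewrite normrM ler_pM.
  by rewrite /phi /psi /kappa; field.
rewrite row_mxEr CxE; apply: (@le_trans _ _ ((c + Nf) * delta)); last by rewrite lerDr.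
by apply: le_trans hI; have := rV_coordB_le (rsubmx (x s)) Is i; rewrite mxE.
Qed.

Let phase_path' s : P (path s).
Proof. by rewrite /phase_space /= row_mxKr. Qed.

Let v_bound s : `|v s| <= Q * Nf + `|mu|.
Proof.
have [_ fb _ _] := fC2; apply: le_trans (ler_normB _ _) _; rewrite lerD2r.
rewrite -mulNr; apply: le_trans (lin2_bound _ _ (fb _ _ _) (fb _ _ _)) _ => //.
by rewrite normrN.
Qed.

(** The first term is the cost of evaluating the force on the resonant path instead of the orbit,
    the second that of replacing [w] by [lam]. Neither [eps] nor [delta] occurs, so [delta] may be
    chosen afterwards. *)
Definition drift_error : R :=
  `|lam| * (Q * (Nf * Cx)) + (Q * Nf + `|mu|) * Cphi.

(** Over the time [delta / eps] the mean force moves the action across [k] by [|mu| * delta].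
    Multiplying by [lam] matches the slope of [V (phi t)], about [lam * v]; the corrector
    contributes at most [2 * b * eps], which [eps <= delta ^+ 2] absorbs. *)
Lemma drift_lower_bound :
  `|lam| * `|mu| * delta <=
  `|lam| * (Q * `|rsubmx (x T) - rsubmx (x 0)|) + (2 * b + drift_error) * delta ^+ 2.
Proof.
have [_ fb fl _] := fC2.
have wb s : 0 <= s -> s <= T -> `|w s| <= Qk * (Nh + Nf).
  move=> s0 sT; apply: lin2_bound;
  by apply: (vel_theta_bound hC2 fC2 eps0 eps1); exact: inP.
have phi_exp : expands T phi w by apply: expands_shift; exact: expands_lin.
have V_exp := expands_comp VE v_bound phi_exp wb.
pose J t : R := k0 * x t 0 (rshift 2 1) + - k1 * x t 0 (rshift 2 0).
have J_exp : expands T J (fun s => k0 * vI 1 (x s) + - k1 * vI 0 (x s)).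
  exact: expands_lin.
(* The corrector [V] absorbs the oscillation of the slope of [J]. *)
pose E t : R := 1 * (lam * J t + eps * V (phi t)) + 1 * (eps * lam * mu * t + 0).
have E_exp := expands_lin 1 1 (expands_lin lam eps J_exp V_exp)
  (expands_affine T (eps * lam * mu) 0).
have := expands_bound E_exp (A := eps * (drift_error * delta)) _ (lexx 0) T0 (lexx _).
rewrite -/(E T) -/(E 0) => H.
have {H}HE : `|E T - E 0| <= drift_error * delta ^+ 2.
  rewrite (_ : drift_error * delta ^+ 2 = eps * (drift_error * delta) * (T - 0)).
    apply: H => s s0 sT.
    have hp := path_near s0 sT; have hw := w_near s0 sT.
    have Ps := inP s0 sT; have Pp := phase_path' (phi s).
    have fn j : `|fd j (x s) - fd j (path (phi s))| <= Nf * Cx * delta.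
      apply: le_trans (fl j _ _ Pp Ps) _; rewrite -mulrA ler_wpM2l //; exact: ltW.
    have vb := v_bound (phi s).
    (* With the force evaluated on the path, [lam * J] has slope [- eps * lam * (v + mu)]. The term
       [eps * w * v] of the corrector and the added [eps * lam * mu] cancel it up to
       [eps * v * (w - lam)]. *)
    rewrite (_ : _ + _ = eps * (- lam * (k0 * (fd (lshift 2 1) (x s) - fd (lshift 2 1) (path (phi s)))
      + - k1 * (fd (lshift 2 0) (x s) - fd (lshift 2 0) (path (phi s))))
      + v (phi s) * (w s - lam))); last first.
      rewrite /vel_I /v.
      move: (fd _ (x s)) (fd _ (x s)) (fd _ (path _)) (fd _ (path _)) (w s) => *.
      by ring.
    rewrite normrM (gtr0_norm eps0) ler_wpM2l ?(ltW eps0) //.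
    apply: le_trans (ler_normD _ _) _; rewrite !normrM normrN /drift_error [leRHS]mulrDl.
    apply: lerD.
      rewrite -mulrA ler_wpM2l //.
      apply: le_trans (lin2_bound _ _ (fn _) (fn _)) _; rewrite normrN -/Q.
      by rewrite !mulrA.
    by rewrite -mulrA ler_pM.
  rewrite subr0 mulrAC epsT; ring.
have EE : E T - E 0 = lam * (J T - J 0) + eps * (V (phi T) - V (phi 0)) + lam * mu * delta.
  rewrite /E -epsT; move: (V _) (V _) (J T) (J 0) => *; ring.
have hJ : `|J T - J 0| <= Q * `|rsubmx (x T) - rsubmx (x 0)|.
  rewrite (_ : J T - J 0 = k0 * (rsubmx (x T) 0 1 - rsubmx (x 0) 0 1)
     + - k1 * (rsubmx (x T) 0 0 - rsubmx (x 0) 0 0)); last first.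
    rewrite /J !mxE; ring.
  apply: le_trans (lin2_bound _ _ (rV_coordB_le _ _ _) (rV_coordB_le _ _ _)) _.
  by rewrite normrN.
have hV : `|eps * (V (phi T) - V (phi 0))| <= 2 * b * delta ^+ 2.
  rewrite normrM (gtr0_norm eps0) [leRHS]mulrC ler_pM // ?(ltW eps0) //.
  apply: le_trans (ler_normB _ _) _.
  by have := Vb (phi T); have := Vb (phi 0); lra.
have hl : `|lam * (J T - J 0)| <= `|lam| * (Q * `|rsubmx (x T) - rsubmx (x 0)|).
  by rewrite normrM ler_wpM2l.
rewrite EE in HE.
have <- : `|lam * mu * delta| = `|lam| * `|mu| * delta.
  by rewrite !normrM (gtr0_norm delta0).
move: HE hV hl; move: (lam * (J T - J 0)) (eps * (V (phi T) - V (phi 0))) => X Y HE hV hl.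
have h1 := ler_normB (X + Y + lam * mu * delta) (X + Y).
rewrite (_ : _ - (X + Y) = lam * mu * delta) in h1; last by ring.
have h2 := ler_normD X Y.
rewrite [(2 * b + _) * _]mulrDl; lra.
Qed.

End drift.

(** * Instability *)

Lemma lsubmx_norm {R : realType} (x : 'rV[R]_(2 + 2)) : `|lsubmx x| <= `|x|.
Proof. by apply: rV_norm_leP => // i; rewrite mxE rV_coord_le. Qed.

Lemma rsubmx_norm {R : realType} (x : 'rV[R]_(2 + 2)) : `|rsubmx x| <= `|x|.
Proof. by apply: rV_norm_leP => // i; rewrite mxE rV_coord_le. Qed.

Lemma lsubmx_lin {R : realType} (x y z : 'rV[R]_(2 + 2)) (s : R) :
  lsubmx x - lsubmx y - s *: lsubmx z = lsubmx (x - y - s *: z).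
Proof. by apply/rowP => i; rewrite !mxE. Qed.

Lemma rsubmx_lin {R : realType} (x y z : 'rV[R]_(2 + 2)) (s : R) :
  rsubmx x - rsubmx y - s *: rsubmx z = rsubmx (x - y - s *: z).
Proof. by apply/rowP => i; rewrite !mxE. Qed.

Lemma trajectory_solution {R : realType} (rho eps K T : R) h f
    (x : R -> 'rV[R]_(2 + 2)) :
  0 < rho -> is_Cr (action_box rho) 1 h -> is_Cr (phase_space rho) 1 f ->
  (forall s t, 0 <= s -> 0 <= t ->
    `|x t - x s - (t - s) *: clamped_field rho
       (fun i => partial_in (action_box rho) i h)
       (fun i => partial_in (phase_space rho) i f) eps (x s)|
    <= K * (t - s) ^+ 2) ->
  (forall t, 0 <= t -> t <= T -> phase_space rho (x t)) ->
  hamiltonian_solution rho (perturbed h eps f) T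
    (fun t => lsubmx (x t)) (fun t => rsubmx (x t)).
Proof.
move=> rho0 [_ dh] [_ df] xE inP t /andP[t0 tT].
have Pt := inP t t0 tT.
have dht i := dh [::] i isT _ Pt.
have dft j := df [::] j isT _ Pt.
have q (s : R) : 0 <= t + s -> `|x (t + s) - x t - s *: clamped_field rho
       (fun i => partial_in (action_box rho) i h)
       (fun i => partial_in (phase_space rho) i f) eps (x t)| <= K * s ^+ 2.
  by move=> ts; have := xE t (t + s) t0 ts; rewrite (_ : t + s - t = s) //; ring.
rewrite hsubmxK.
have -> : grad_I rho (perturbed h eps f) (x t) = lsubmx (clamped_field rho
       (fun i => partial_in (action_box rho) i h)
       (fun i => partial_in (phase_space rho) i f) eps (x t)).
  apply/rowP => i; rewrite /grad_I /clamped_field row_mxKl [RHS]mxE clamp_phase_id //.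
  by rewrite 2!mxE partial_perturbed_I.
have -> : - grad_theta rho (perturbed h eps f) (x t) = rsubmx (clamped_field rho
       (fun i => partial_in (action_box rho) i h)
       (fun i => partial_in (phase_space rho) i f) eps (x t)).
  apply/rowP => i; rewrite /grad_theta /clamped_field row_mxKr [RHS]mxE clamp_phase_id //.
  by rewrite 3!mxE partial_perturbed_theta.
split => //.
- apply: (quadratic_is_derive_in (K := K)) => s /=.
  rewrite in_itv /= [s *: _]mulr1 => /andP[ts _].
  apply: le_trans (q s ts); apply: le_trans (lsubmx_norm _).
  by rewrite lsubmx_lin.
- apply: (quadratic_is_derive_in (K := K)) => s /=.
  rewrite in_itv /= [s *: _]mulr1 => /andP[ts _].
  apply: le_trans (q s ts); apply: le_trans (rsubmx_norm _).
  by rewrite rsubmx_lin.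
Qed.

Lemma is_Cr_le {R : realType} {n} (D : set 'rV[R]_n) r r' f :
  (r <= r')%N -> is_Cr D r' f -> is_Cr D r f.
Proof.
move=> rr [cf df]; split=> [s sr|s i sr]; first by apply: cf; exact: leq_trans rr.
by apply: df; exact: leq_trans rr.
Qed.

(** The values [r] and [- r] are [2 * r] apart; this tells a face from the opposite one. *)
Lemma eq_of_close_norm {R : realType} (x y r : R) : 0 < r ->
  `|x| = r -> `|y| = r -> `|x - y| <= r -> x = y.
Proof.
move=> r0; rewrite ler_norml.
have [x0|x0] := leP 0 x; have [y0|y0] := leP 0 y;
  rewrite ?(ger0_norm x0) ?(ger0_norm y0) ?(ltr0_norm x0) ?(ltr0_norm y0); lra.
Qed.

Lemma dist_set_le {R : realType} (x y : 'rV[R]_2) (A : set 'rV[R]_2) :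
  A y -> dist_set x A <= `|x - y|.
Proof.
by move=> Ay; apply: ge_inf; [exists 0 => _ [z _ <-]|exists y].
Qed.

(* S = segment p q and S^* = segment p' q'. *)
Theorem theorem1p1 (R : realType) (rho : R) (h : 'rV[R]_2 -> R)
    (k : 'rV[int]_2) (a : R) (p q p' q' : 'rV[R]_2) :
  0 < rho ->
  Cr_unit_ball (action_box rho) 4 h ->
  k <> 0 ->
  p <> q ->
  segment p q `<=` resonant_line k a `&` action_box rho ->
  (forall x y, segment p q x -> segment p q y -> h x = h y) ->
  p' <> q' ->
  segment p' q' `<=` segment p q ->
  (forall x, segment p' q' x -> gradient_in (action_box rho) h x <> 0) ->
  exists C c : R, [/\ 1 <= C, 0 < c &
    forall (f : 'rV[R]_(2 + 2) -> R) (Is thetas : 'rV[R]_2),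
      torus_Cr_unit_ball rho 7 f ->
      segment_int p' q' Is ->
      gradient_in setT (resonant_average f k Is) thetas <> 0 ->
      exists eps0 delta : R,
        [/\ 0 < eps0 <= 1, 0 < delta <= 1 &
        forall eps : R, 0 < eps <= eps0 ->
          exists theta I : R -> 'rV[R]_2,
            let tau := delta * eps^-1 in
            [/\ hamiltonian_solution rho (perturbed h eps f) tau theta I,
                `|I 0 - Is| <= c * eps,
                `|I tau - I 0| >= C * delta ^+ 2 &
                forall t : R, 0 <= t <= tau ->
                  dist_set (I t) (segment p' q') <= c * eps]]].
Proof.
move=> rho0 hball kn _ SLB hcst pq' SS hgrad.
pose B := action_box rho; pose P := phase_space rho.
pose hd (i : 'I_2) := partial_in B i h.
have [Nh Nh0 hC2] : exists2 N : R, 0 < N & C2_bounds B h hd N.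
  by apply: (action_C2_bounds (r := 4)) => //; case: hball.
pose kr : 'rV[R]_2 := map_mx intr k.
set k0 : R := kr 0 0; set k1 : R := kr 0 1.
pose kappa : R := k0 ^+ 2 + k1 ^+ 2; pose Q : R := `|k0| + `|k1|.
have kappa0 : 0 < kappa.
  rewrite lt_def addr_ge0 ?sqr_ge0 // andbT paddr_eq0 ?sqr_ge0 // !sqrf_eq0.
  apply/negP; rewrite /k0 /k1 !mxE !intr_eq0 => /andP[/eqP e0 /eqP e1]; apply: kn.
  by apply/rowP => i; rewrite mxE; case: (ord2P i) => ->.
have Q0 : 0 < Q.
  rewrite lt_def addr_ge0 // andbT paddr_eq0 // !normr_eq0; apply/negP.
  by move=> /andP[/eqP e0 /eqP e1]; move: kappa0; rewrite /kappa e0 e1 expr0n addr0 ltxx.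
have S_line x : segment p' q' x -> k0 * x 0 0 + k1 * x 0 1 + a = 0.
  by move=> /SS/SLB[]; rewrite /resonant_line /= /k0 /k1 !mxE.
have S_box x : segment p' q' x -> B x by move=> /SS/SLB[].
have S_cst x y : segment p' q' x -> segment p' q' y -> h x = h y.
  by move=> /SS Sx /SS Sy; exact: hcst.
have [lam0 lam00 Hlam0] : exists2 lam : R, 0 < lam &
    forall y, segment p' q' y -> lam <= `|k0 * hd 0 y + k1 * hd 1 y|.
  apply: (segment_transverse_min Nh0 hC2 kappa0 S_line S_box S_cst pq') => x Sx.
  apply: contrapT => /not_orP[/contrapT e0 /contrapT e1].
  by apply: (hgrad x Sx); apply: rV2P; rewrite !mxE.
(* A contact with the face would give [m * eps * rho * lam0 <= 2 * Q * (2 * eps)] by [face_barrier]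
   and the energy bound; any constant above 4 in place of 5 excludes it. *)
pose m := 5 * Q / (rho * lam0).
have rl0 : 0 < rho * lam0 by rewrite mulr_gt0.
have m0 : 0 < m by rewrite divr_gt0 // mulr_gt0.
have mE : m * rho * lam0 = 5 * Q by rewrite /m; field; rewrite !gt_eqF.
(* The first term pays for the shift of the starting point, the second is the distance allowed by an
   energy difference of [(2 + Nh * (m * rho)) * eps]. Nothing here depends on [f]. *)
pose c := m * rho + 2 * Q * (2 + Nh * (m * rho)) / lam0.
have mr0 : 0 < m * rho by rewrite mulr_gt0.
have c20 : 0 < 2 * Q * (2 + Nh * (m * rho)) / lam0.
  by rewrite divr_gt0 // mulr_gt0 ?mulr_gt0 // addr_gt0 // mulr_gt0.
have c0 : 0 < c by rewrite addr_gt0.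
exists 1, c; split => // f Is thetas [pf fball] Isint avg.
case: (Isint) => SIs _; have BIs := S_box _ SIs.
have f1 x : P x -> `|f x| <= 1 by exact: Cr_unit_ball_le1 fball.
pose fd (i : 'I_(2 + 2)) := partial_in P i f.
have [Nf Nf0 fC2] : exists2 N : R, 0 < N & C2_bounds P f fd N.
  by apply: (phase_C2_bounds (r := 7)) => //; case: fball.
have [mu [V [b [K' [mun Vb VE]]]]] := resonant_drift Nf0 pf fC2 BIs kappa0 avg.
have [r r0 Hr] := energy_controls_distance Nh0 hC2 kappa0 S_line S_box S_cst pq'
  lam00 Hlam0 Isint.
pose lam : R := k0 / kappa * hd 0 Is + k1 / kappa * hd 1 Is.
have lamn : 0 < `|lam|.
  have -> : lam = (k0 * hd 0 Is + k1 * hd 1 Is) / kappa by rewrite /lam; ring.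
  rewrite normrM normfV (gtr0_norm kappa0) divr_gt0 //.
  exact: lt_le_trans (Hlam0 _ SIs).
(* Away from a face, half the distance to it keeps the orbit off that face. When [Is] is on a face,
   the value [rho] only excludes the opposite one, and the energy barrier does the rest. *)
pose gap (i : 'I_2) : R := if `|Is 0 i| < rho then (rho - `|Is 0 i|) / 2 else rho.
have gap0 i : 0 < gap i by rewrite /gap; case: ifP => // h1; rewrite divr_gt0 // subr_gt0.
pose r' := Num.min r (Num.min (gap 0) (gap 1)).
have r'0 : 0 < r' by rewrite !lt_min r0 !gap0.
have r'r : r' <= r by rewrite ge_min lexx.
have r'gap i : r' <= gap i by case: (ord2P i) => ->; rewrite /r' !ge_min lexx !orbT.
pose err := drift_error hd Nh Nf c kr Is mu.
have b0 : 0 <= b by exact: le_trans (normr_ge0 _) (Vb 0).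
(* With [delta * Z <= |lam| * |mu|], the summands [2 * b] and [|err|] absorb the errors of
   [drift_lower_bound], and [|lam| * Q] leaves a drift of at least [delta ^+ 2], that is,
   [C = 1]. *)
pose Z := `|lam| * Q + 2 * b + `|err| + 1.
have Z0 : 0 < Z.
  have := mulr_gt0 lamn Q0; have := normr_ge0 err; rewrite /Z; lra.
have cN0 : 0 < c + Nf by rewrite addr_gt0.
have mun0 : 0 < `|mu| by rewrite normr_gt0.
pose delta := Num.min 1 (Num.min (r' / (c + Nf)) (`|lam| * `|mu| / Z)).
have delta0 : 0 < delta by rewrite !lt_min ltr01 !divr_gt0 // mulr_gt0.
have delta1 : delta <= 1 by rewrite ge_min lexx.
have delta_r : (c + Nf) * delta <= r'.
  by rewrite mulrC -ler_pdivlMr // /delta !ge_min lexx !orbT.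
have delta_Z : delta * Z <= `|lam| * `|mu|.
  by rewrite -ler_pdivlMr // /delta !ge_min lexx !orbT.
(* The bound [m^-1] keeps [1 - m * eps] nonnegative, so that the shifted start [J] stays in the
   box. *)
pose eps0 := Num.min (delta ^+ 2) m^-1.
have d20 : 0 < delta ^+ 2 by rewrite exprn_gt0.
have d21 : delta ^+ 2 <= delta.
  by rewrite expr2 -[leRHS]mulr1 ler_wpM2l // ltW.
exists eps0, delta; split.
- by rewrite lt_min d20 invr_gt0 m0 /= ge_min (le_trans d21 delta1).
- by rewrite delta0 delta1.
move=> eps /andP[ep0]; rewrite le_min => /andP[ep_d ep_m].
have ep1 : eps <= 1 by exact: le_trans ep_d (le_trans d21 delta1).
have me0 : 0 < m * eps by rewrite mulr_gt0.
have me1 : m * eps <= 1 by rewrite mulrC -ler_pdivlMr // div1r.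
(* The shift makes [h J] differ by more than [2 * eps] from [h] on any face of the
   box that contains the segment. *)
pose J : 'rV[R]_2 := (1 - m * eps) *: Is.
have IsR : `|Is| <= rho by case: BIs => *; exact: rV2_norm_le.
have JIs : `|J - Is| <= m * rho * eps.
  have -> : J - Is = - (m * eps) *: Is.
    by rewrite /J -[X in _ - X]scale1r -scalerBl; congr (_ *: _); ring.
  by rewrite normrZ normrN (gtr0_norm me0) -mulrA (mulrC rho) mulrA ler_wpM2l // ltW.
have BJ : B J.
  apply/action_boxP => i; rewrite -ler_norml mxE normrM (@ger0_norm _ (1 - _)) ?subr_ge0 //.
  rewrite -[leRHS]mul1r ler_pM ?subr_ge0 ?lerBlDr ?lerDl ?(ltW me0) //.
  exact: le_trans (rV_coord_le _ _) IsR.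
have JIs_c : `|J - Is| <= c * eps.
  apply: le_trans JIs _; rewrite ler_wpM2r ?(ltW ep0) // /c; lra.
have [x [x0 xE]] := cauchy_lipschitz (row_mx thetas J) (addr_gt0 Nh0 Nf0)
  (clamped_field_lipschitz rho0 Nh0 Nf0 hC2 fC2 ep0 ep1)
  (clamped_field_bound rho0 Nh0 Nf0 hC2 fC2 ep0 ep1).
have Ix0 : rsubmx (x 0) = J by rewrite x0 row_mxKr.
set T := delta * eps^-1.
have T0 : 0 <= T by rewrite divr_ge0 // ltW.
have epsT : eps * T = delta by rewrite /T mulrC divfK // gt_eqF.
have I_near t : 0 <= t -> t <= T -> `|rsubmx (x t) - Is| <= r'.
  move=> t0 tT; apply: le_trans delta_r.
  have h1 := action_lipschitz rho0 Nf0 fC2 ep0 xE (lexx 0) t0.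
  have h2 : eps * Nf * (t - 0) <= Nf * delta.
    by rewrite subr0 -epsT mulrAC [leRHS]mulrC ler_wpM2r ?(ltW Nf0) // ler_wpM2l // ltW.
  have h3 : c * eps <= c * delta by rewrite ler_wpM2l ?(ltW c0) // (le_trans ep_d).
  rewrite Ix0 in h1.
  have -> : rsubmx (x t) - Is = (rsubmx (x t) - J) + (J - Is) by rewrite addrA subrK.
  apply: le_trans (ler_normD _ _) _; lra.
have Jr : `|J - Is| <= r by rewrite -Ix0; exact: le_trans (I_near 0 (lexx _) T0) r'r.
(* The horizon [S] is left free: it is the current time inside the continuation argument, and [T]
   once confinement is known. *)
have h_energy S t : 0 <= t -> t <= S -> (forall s, 0 <= s -> s <= S -> P (x s)) ->
    `|h (rsubmx (x t)) - h J| <= 2 * eps.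
  move=> t0 tS inP.
  have := energy_conservation rho0 Nh0 Nf0 hC2 fC2 ep0 ep1 xE inP t0 tS.
  rewrite /perturbed Ix0 => E.
  have -> : h (rsubmx (x t)) - h J = eps * (f (x 0) - f (x t)) by lra.
  rewrite normrM (gtr0_norm ep0) mulrC ler_wpM2r ?(ltW ep0) //.
  apply: le_trans (ler_normB _ _) _.
  have := f1 _ (inP 0 (lexx _) (le_trans t0 tS)); have := f1 _ (inP t t0 tS); lra.
have inP : forall t, 0 <= t -> t <= T -> P (x t).
  apply: (trajectory_stays rho0 Nh0 Nf0 hC2 fC2 ep0 ep1 xE).
    by rewrite /P /phase_space /= Ix0.
  move=> t t0 tT inPt i.
  have hE := h_energy t t t0 (lexx _) inPt.
  have In := I_near t t0 tT; have Pt := inPt t t0 (lexx _).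
  have Ii := le_trans (rV_coordB_le (rsubmx (x t)) Is i) (le_trans In (r'gap i)).
  have Bi := proj1 (action_boxP rho _) Pt i; rewrite -ler_norml in Bi.
  have Bsi := proj1 (action_boxP rho _) BIs i; rewrite -ler_norml in Bsi.
  move: Ii; rewrite /gap; case: ifPn => [lt Ii|].
    have := ler_normD (Is 0 i) (rsubmx (x t) 0 i - Is 0 i).
    by rewrite addrC subrK; lra.
  (* Now [Is] is on a face. Were the orbit on a face in the same coordinate, closeness to [Is] would
     make it the same face, and [face_barrier] would yield [5 * Q * eps <= 4 * Q * eps]. *)
  rewrite -leNgt => ge Ii.
  have Isi : `|Is 0 i| = rho by apply/eqP; rewrite eq_le Bsi ge.
  rewrite lt_neqAle Bi andbT; apply/eqP => Iti.
  have Ieq : rsubmx (x t) 0 i = Is 0 i.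
    exact: eq_of_close_norm rho0 Iti Isi Ii.
  have := face_barrier kappa0 S_line S_box S_cst pq' lam00 Isint Hr (ltW me0) Isi
    Pt (le_trans In r'r) Ieq BJ Jr.
  have -> : m * eps * rho * lam0 = 5 * Q * eps by rewrite -mE; ring.
  rewrite -/J distrC => hb.
  have h2 : 2 * Q * `|h (rsubmx (x t)) - h J| <= 2 * Q * (2 * eps).
    by rewrite ler_wpM2l // mulr_ge0 // ltW.
  have := mulr_gt0 Q0 ep0; move: (le_trans hb h2); lra.
have near t : 0 <= t -> t <= T -> exists y,
    segment p' q' y /\ `|rsubmx (x t) - y| <= c * eps.
  move=> t0 tT; have In := le_trans (I_near t t0 tT) r'r.
  have [y [Sy Iy hs]] := Hr _ (inP t t0 tT) In.
  exists y; split => //; apply: le_trans Iy _.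
  set sigma := _ / _ in hs *.
  have [hlip _ _ _] := hC2.
  have e1 := h_energy T t t0 tT inP.
  have e2 := hlip _ _ BIs BJ.
  have e3 : Nh * `|J - Is| <= Nh * (m * rho * eps) by rewrite ler_wpM2l // ltW.
  (* The energy is compared with that of the segment through the start [J]: [2 * eps] comes from the
     perturbation, [Nh * (m * rho) * eps] from the shift. *)
  have e4 := ler_normD (h (rsubmx (x t)) - h J) (h J - h Is).
  rewrite addrA subrK in e4.
  have e5 : `|sigma| * lam0 <= 2 * (2 + Nh * (m * rho)) * eps.
    apply: le_trans hs _; lra.
  rewrite -ler_pdivlMr // in e5.
  apply: le_trans (ler_wpM2l (ltW Q0) e5) _.
  have -> : Q * (2 * (2 + Nh * (m * rho)) * eps / lam0) =
    2 * Q * (2 + Nh * (m * rho)) / lam0 * eps by ring.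
  by rewrite ler_wpM2r ?(ltW ep0) // /c; lra.
exists (fun t => lsubmx (x t)), (fun t => rsubmx (x t)) => /=; split.
- apply: trajectory_solution xE inP => //.
    by apply: is_Cr_le (proj1 hball).
  by apply: is_Cr_le (proj1 fball).
- by rewrite Ix0.
- rewrite mul1r.
  have nr t : 0 <= t -> t <= T -> exists y,
      [/\ B y, k0 * hd 1 y - k1 * hd 0 y = 0 & `|rsubmx (x t) - y| <= c * eps].
    move=> t0 tT; have [y [Sy hy]] := near t t0 tT; exists y; split => //.
      exact: S_box.
    exact: (segment_tangential hC2 S_line S_box S_cst pq').
  have := drift_lower_bound rho0 Nh0 Nf0 hC2 fC2 ep0 ep1 xE delta0 delta1 ep_d
    (ltW c0) inP kappa0 BIs (thetas := thetas) _ _ nr Vb VE.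
  rewrite Ix0 x0 row_mxKl -/lam -/Q -/err -/T => /(_ erefl JIs_c).
  set D := `|_ - J| => H.
  have h1 : delta ^+ 2 * Z <= `|lam| * `|mu| * delta.
    by rewrite expr2 -mulrA [leRHS]mulrC ler_wpM2l // ltW.
  have h2 : err * delta ^+ 2 <= `|err| * delta ^+ 2.
    by rewrite ler_wpM2r ?(ltW d20) // ler_norm.
  rewrite -(ler_pM2l (mulr_gt0 lamn Q0)).
  move: h1 h2 H d20; rewrite /Z; move: (delta ^+ 2) => d2 h1 h2 H d20.
  by lra.
move=> t /andP[t0 tT]; have [y [Sy hy]] := near t t0 tT.
exact: le_trans (dist_set_le _ Sy) hy.
Qed.
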